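(* Let $(\delta,K_1,K_2,C_0,C_1,\mathcal S)$ be a primitive admissible sequence of parameters such that $\mathcal S$ is a non-empty set of Henson constraints. Then the class $\overrightarrow{\mathcal K}$ of free linear orderings of $\mathcal K=\mathcal A^\delta_{K_1,K_2,C_0,C_1}\cap\mathcal A_{\mathcal S}$ is Ramsey and has the expansion property.
   Context: $\mathcal A^\delta_{K_1,K_2,C_0,C_1}$ is the class of finite metric spaces with integer distances in $\{1,\dots,\delta\}$ such that for every triangle with perimeter $p$ and shortest side $m$: if $p$ odd then $2K_1<p<2K_2+2m$ and $p<C_1$; if $p$ even then $p<C_0$. With $C=\min(C_0,C_1)$, $C'=\max(C_0,C_1)$, numerical parameters are primitive admissible if: $3\le\delta<\infty$; $1\le K_1\le K_2\le 2\delta$; $2\delta<C_0,C_1\le3\delta+2$, $C_0$ even, $C_1$ odd; $C_0,C_1\ge 2\delta+2$; and either (II) $C\le 2\delta+K_1$, $C=2K_1+2K_2+1$, $K_1+K_2\ge\delta$, $K_1+2K_2\le 2\delta-1$, and ($C'=C+1$, or $C'>C+1$, $K_1=K_2$, $3K_2=2\delta-1$); or (III) $C>2\delta+K_1$, $K_1+2K_2\ge2\delta-1$, $3K_2\ge2\delta$, if $K_1+2K_2=2\delta-1$ then $C\ge2\delta+K_1+2$, and if $C'>C+1$ then $C\ge 2\delta+K_2$. A Henson constraint is a $(1,\delta)$-space, i.e. a metric space all of whose distances are $1$ or $\delta$. $\mathcal A_{\mathcal S}$ is the class of finite metric spaces into which no member of $\mathcal S$ embeds. The sequence $(\delta,K_1,K_2,C_0,C_1,\mathcal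 S)$ is primitive admissible if the numerical parameters are primitive admissible, $\mathcal S$ is a set of $(1,\delta)$-spaces each with at least 4 points and containing no triangle forbidden in $\mathcal A^\delta_{K_1,K_2,C_0,C_1}$, and in Case (III): if $K_1=\delta$ then $\mathcal S=\emptyset$, and if $C=2\delta+2$ then $\mathcal S=\emptyset$. A free linear ordering is an expansion by an arbitrary linear order. A class $\mathcal C$ is Ramsey if for all $\mathbf A,\mathbf B\in\mathcal C$ and $k\ge1$ there is $\mathbf C\in\mathcal C$ such that for every $k$-colouring of the copies of $\mathbf A$ in $\mathbf C$ some copy of $\mathbf B$ in $\mathbf C$ has all its copies of $\mathbf A$ of one colour. A class $\mathcal K^+$ of expansions of $\mathcal K$ has the expansion property if for every $\mathbf A\in\mathcal K$ there is $\mathbf B\in\mathcal K$ such that every expansion of $\mathbf A$ in $\mathcal K^+$ embeds into every expansion of $\mathbf B$ in $\mathcal K^+$. *)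

(* Defs.v *)
From mathcomp Require Import all_boot.

Set Implicit Arguments.
Unset Strict Implicit.
Unset Printing Implicit Defensive.

Definition is_metric (T : Type) (d : T -> T -> nat) : Prop :=
  [/\ forall x y, d x y = 0 <-> x = y,
      forall x y, d x y = d y x
    & forall x y z, d x z <= d x y + d y z].

(* Used for the forbidden spaces, which are not required to be finite. *)
Record mspace := MSpace {
  mcarrier :> Type;
  mdist : mcarrier -> mcarrier -> nat;
  mdistP : is_metric mdist }.

Record finspace := FinSpace {
  fcarrier :> finType;
  fdist : fcarrier -> fcarrier -> nat;
  fdistP : is_metric fdist }.

(* Such an f is injective, since distances separate points. *)
Definition isometric (T U : Type) (d : T -> T -> nat) (e : U -> U -> nat)
    (f : T -> U) : Prop :=
  forall x y, e (f x) (f y) = d x y.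

Record params := Params {
  delta : nat; K1 : nat; K2 : nat; C0 : nat; C1 : nat }.

Definition Cmin (P : params) : nat := minn (C0 P) (C1 P).
Definition Cmax (P : params) : nat := maxn (C0 P) (C1 P).

Definition triangle_allowed (P : params) (a b c : nat) : Prop :=
  let p := a + b + c in
  let m := minn a (minn b c) in
  (odd p -> 2 * K1 P < p < 2 * K2 P + 2 * m /\ p < C1 P) /\
  (~~ odd p -> p < C0 P).

Definition no_forbidden_triangle (P : params) (T : Type) (d : T -> T -> nat)
    : Prop :=
  forall x y z : T, x <> y -> y <> z -> x <> z ->
    triangle_allowed P (d x y) (d y z) (d x z).

Definition class_A (P : params) (X : finspace) : Prop :=
  (forall x y : X, x <> y -> 1 <= fdist x y <= delta P) /\
  no_forbidden_triangle P (@fdist X).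

Definition class_AS (S : mspace -> Prop) (X : finspace) : Prop :=
  forall H : mspace, S H ->
    ~ exists f : H -> X, isometric (@mdist H) (@fdist X) f.

Definition class_K (P : params) (S : mspace -> Prop) (X : finspace) : Prop :=
  class_A P X /\ class_AS S X.

Definition case_II (P : params) : Prop :=
  [/\ Cmin P <= 2 * delta P + K1 P,
      Cmin P = 2 * K1 P + 2 * K2 P + 1,
      K1 P + K2 P >= delta P,
      K1 P + 2 * K2 P <= 2 * delta P - 1
    & Cmax P = Cmin P + 1 \/
      [/\ Cmax P > Cmin P + 1, K1 P = K2 P & 3 * K2 P = 2 * delta P - 1]].

Definition case_III (P : params) : Prop :=
  [/\ Cmin P > 2 * delta P + K1 P,
      K1 P + 2 * K2 P >= 2 * delta P - 1,
      3 * K2 P >= 2 * delta P,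
      K1 P + 2 * K2 P = 2 * delta P - 1 -> Cmin P >= 2 * delta P + K1 P + 2
    & Cmax P > Cmin P + 1 -> Cmin P >= 2 * delta P + K2 P].

Definition primitive_admissible_params (P : params) : Prop :=
  [/\ 3 <= delta P,
      1 <= K1 P /\ K1 P <= K2 P /\ K2 P <= 2 * delta P,
      [/\ 2 * delta P < C0 P <= 3 * delta P + 2,
          2 * delta P < C1 P <= 3 * delta P + 2,
          ~~ odd (C0 P) & odd (C1 P)],
      2 * delta P + 2 <= C0 P /\ 2 * delta P + 2 <= C1 P
    & case_II P \/ case_III P].

Definition one_delta_space (P : params) (H : mspace) : Prop :=
  forall x y : H, x <> y -> mdist x y = 1 \/ mdist x y = delta P.

Definition primitive_admissible (P : params) (S : mspace -> Prop) : Prop :=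
  [/\ primitive_admissible_params P,
      forall H, S H ->
        [/\ one_delta_space P H,
            exists f : 'I_4 -> H, injective f
          & no_forbidden_triangle P (@mdist H)]
    & case_III P ->
        (K1 P = delta P -> forall H, ~ S H) /\
        (Cmin P = 2 * delta P + 2 -> forall H, ~ S H)].

(* Reflexivity is the diagonal case of totality. *)
Record lin_order (T : Type) := LinOrder {
  lo_rel :> rel T;
  lo_total : total lo_rel;
  lo_trans : transitive lo_rel;
  lo_anti : antisymmetric lo_rel }.

Record ordspace := OrdSpace {
  reduct :> finspace;
  order_of : lin_order reduct }.

Definition free_orderings (K : finspace -> Prop) (X : ordspace) : Prop :=
  K (reduct X).

Definition oembedding (A B : ordspace) (f : A -> B) : Prop :=
  isometric (@fdist A) (@fdist B) f /\
  (forall x y, order_of B (f x) (f y) = order_of A x y).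

(* Substructures, identified with their sets of points. *)
Definition is_copy (A C : ordspace) (X : {set C}) : Prop :=
  exists f : A -> C, oembedding f /\ X = [set f a | a : A].

(* A colouring is a total function on subsets; only its values on copies
   of A matter. *)
Definition Ramsey (KK : ordspace -> Prop) : Prop :=
  forall (A B : ordspace) (k : nat), KK A -> KK B -> 1 <= k ->
    exists C : ordspace, KK C /\
      forall chi : {set C} -> 'I_k,
        exists (B' : {set C}) (c : 'I_k), is_copy B B' /\
          forall A' : {set C}, is_copy A A' -> A' \subset B' -> chi A' = c.

Definition expansion_property (K : finspace -> Prop) (KK : ordspace -> Prop)
    : Prop :=
  forall A : finspace, K A ->
    exists B : finspace, K B /\
      forall (a : lin_order A) (b : lin_order B),
        KK (OrdSpace a) -> KK (OrdSpace b) ->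
        exists f : OrdSpace a -> OrdSpace b, oembedding f.

(* Main.v *)
(* Fix a distance M about delta/2 such that every triangle (M, M, j) is allowed, and
   write a (+) b for the set of labels closing a triangle with sides a and b. This
   operation is associative, every iterated sum is closed upwards below a top element for a
   tree order with root M, so pairwise intersecting sums have a common element, and every
   sufficiently long sum contains all labels. Therefore an edge-labelled graph all of
   whose short closed walks have 0 in their sum is consistent along all closed walks,
   and it can be completed one edge at a time to a member of A^delta; afterwards the new
   distances 1 and delta can be replaced by others, so that no Henson constraint appears
   outside the cliques of the graph.

   Starting from Ramsey's theorem, iterating the partite construction (based on the
   Hales-Jewett theorem) yields ordered edge-labelled graphs arrowing the given spaces,
   without Henson cliques and consistent along closed walks of length k, for larger and
   larger k. Completing such a graph gives the Ramsey property.

   For the expansion property, colour the pairs at distance d by whether a second order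
   agrees with the first one. The Ramsey property makes all these colours constant on a
   copy of a suitable space, triangles (M, M, d) make them equal for all d, and the space
   contains A with all of its orders, at mutual distance M. *)
From Stdlib Require Import ZArith Lia Classical.

(** * Allowed triangles *)

(** A new edge has to close all walks between its ends at once, whereas consistency of closed walks
    says only that the sums of any two such walks meet. The tree order exists to pass from pairs to
    all walks; it respects parity because odd and even perimeters obey different bounds, so that a
    sum may skip every second label far from M.

    The non-emptiness of [S] enters through Case (III), where it excludes K1 = delta and C = 2 delta
    + 2. The first leaves room for M < delta; since M > 1 as well, M is not a distance of a Henson
    constraint, and points can be separated by M without creating one. The second gives C0 >= 2
    delta + 4, so (a, a, 2) is allowed for each label a: long sums can grow in steps of 2, and a
    distance 1 can be replaced by 2 or 3.

    Consistency is gained one length at a time because a walk between different copies in an amalgam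
    is controlled only by its projection to the previous stage. *)

Section AllowedTriangles.
Local Open Scope Z_scope.
Variables d K1 K2 C0 C1 M kap : Z.
Variable tie : Prop.

(* The value 0 is admitted as a neutral element: [tri 0 b c] holds iff [b = c], for [0 <= 2*b < C0]. *)
Definition tri a b c := c <= a+b /\ a <= b+c /\ b <= a+c /\
  ((exists q, a+b+c= 2*q /\ a+b+c < C0) \/
  (exists q, a+b+c= 2*q+1 /\ 2*K1 < a+b+c /\ a+b+c<C1 /\ b+c<2*K2+a /\ a+c<2*K2+b /\ a+b<2*K2+c)).

(* [below x c]: [c] is reached from [x] by moving towards [M], either in steps
   of 2 or into the range where the parity of a perimeter no longer matters ([kap]
   bounds it for labels smaller than [M], [K2] for larger ones). This is a tree
   order with root [M]. The flag [tie] marks the subcase C' > C + 1 of (II), where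
   [M + 1] lies above all smaller labels of its parity as well. *)
Definition below x c := c = M \/ (x<=c<M /\ ((exists r, c-x= 2*r) \/ kap <= c)) \/ (M<c<=x /\
  ((exists r, c-x= 2*r) \/ c < K2)) \/ (tie /\ (x <= M+1 /\ c = M+1) /\ exists r, c-x= 2*r).

Lemma tri_even a b c q : a+b+c= 2*q -> c <= a+b -> a <= b+c -> b <= a+c -> a+b+c<C0 -> tri a b c.
Proof. intros; unfold tri; repeat split; try lia; left; exists q; lia. Qed.

Lemma tri_odd a b c q : a+b+c= 2*q+1 -> c <= a+b -> a <= b+c -> b <= a+c -> 2*K1 < a+b+c ->
  a+b+c<C1 -> b+c<2*K2+a -> a+c<2*K2+b -> a+b<2*K2+c -> tri a b c.
Proof. intros; unfold tri; repeat split; try lia; right; exists q; lia. Qed.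

Lemma tri_even_or a b c q : a+b+c= 2*q -> tri a b c \/ (c > a+b \/ a > b+c \/ b > a+c \/ a+b+c>=C0).
Proof. intros.
destruct (Z_lt_ge_dec (a+b) c); [lia|]. destruct (Z_lt_ge_dec (b+c) a); [lia|].
destruct (Z_lt_ge_dec (a+c) b); [lia|]. destruct (Z_lt_ge_dec (a+b+c) C0); [|lia].
left; apply (tri_even _ _ _ q); lia. Qed.

Lemma tri_odd_or a b c q : a+b+c= 2*q+1 -> tri a b c \/ (c > a+b \/ a > b+c \/ b > a+c \/
  2*K1 >= a+b+c \/ a+b+c>=C1 \/ b+c>= 2*K2+a \/ a+c>= 2*K2+b \/ a+b>= 2*K2+c).
Proof. intros.
destruct (Z_lt_ge_dec (a+b) c); [lia|]. destruct (Z_lt_ge_dec (b+c) a); [lia|].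
destruct (Z_lt_ge_dec (a+c) b); [lia|]. destruct (Z_lt_ge_dec (2*K1) (a+b+c)); [|lia].
destruct (Z_lt_ge_dec (a+b+c) C1); [|lia].
destruct (Z_lt_ge_dec (b+c) (2*K2+a)); [|lia]. destruct (Z_lt_ge_dec (a+c) (2*K2+b)); [|lia].
destruct (Z_lt_ge_dec (a+b) (2*K2+c)); [|lia].  left; apply (tri_odd _ _ _ q); lia. Qed.

Lemma below_low x c : x<=c<=M -> (exists r, c-x= 2*r) \/ kap<=c \/ c = M -> below x c.
Proof. intros h h'; unfold below; destruct (Z.eq_dec c M); [left; lia|right; left]. split; [lia|].
destruct h' as [h'|[h'|h']]; [left; assumption|right; assumption|lia]. Qed.

Lemma below_high x c : M<=c<=x -> (exists r, c-x= 2*r) \/ c<K2 \/ c = M -> below x c.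
Proof. intros h h'; unfold below; destruct (Z.eq_dec c M); [left; lia|right; right; left].
split; [lia|]. destruct h' as [h'|[h'|h']]; [left; assumption|right; assumption|lia]. Qed.

Lemma below_M x : below x M. Proof. left; reflexivity. Qed.

(** One half-difference [r] is fixed for all alternatives, so that the case distinctions below are
    pure linear arithmetic without existentials. *)
Lemma below_cases x c : below x c -> exists r, (c-x= 2*r \/ c-x = 2*r+1) /\ (c = M \/ (x<=c<M /\
  (c-x= 2*r \/ kap <= c)) \/ (M<c<=x /\ (c-x= 2*r \/ c<K2)) \/ (tie /\ (x<=M+1 /\ c=M+1) /\
  c-x= 2*r)).
Proof.
intros [H|[(H1&H2)|[(H1&H2)|(H1&H2&H3)]]]; destruct (Z.Even_or_Odd (c-x)) as [[r h]|[r h]];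
  exists r; (split; [first [left; assumption|right; assumption]|]);
first [left; assumption | right; left; split; [clear -H1; lia|]; first [left; assumption |
  destruct H2 as [[r' H3]|H3]; [exfalso; clear -H3 h; lia|right; assumption]]
 | right; right; left; split; [clear -H1; lia|];  first [left; assumption |
   destruct H2 as [[r' H3]|H3]; [exfalso; clear -H3 h; lia|right; assumption]] |
 right; right; right; split; [assumption|]; split; [assumption|]; try assumption;
   destruct H3 as [r' H3]; exfalso; clear -H3 h; lia].
Qed.

(** The bounds 2*d+1+kap <= C0, C1 keep the tops [C0-1-a-m] and [C1-1-a-m] in the range from [kap]
    on, where parity is irrelevant. The last line says that C0 and C1 are consecutive or that the
    perimeter bounds never exclude [M]. *)
Definition boundsIII := ~ tie /\ 2*d-1 <= K1+2*K2 /\ 2*d <= 3*K2 /\ 2*d <= M+2*K2 /\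
  2*d <= kap+2*K2 /\ 2*d+1+kap <= C0 /\ 2*d+1+kap <= C1 /\ 2 <= kap /\ K1 <= kap <= K1+1 /\
 (C1 = C0+1 \/ C0 = C1+1 \/ (2*d+K2 <= C0 /\ 2*d+K2<=C1 /\ 2*d+M < C0 /\ 2*d+M<C1)).

Definition boundsII := ~ tie /\ C1 <= 2*d+K1 /\ C1 = 2*K1+2*K2+1 /\ d <= K1+K2 /\
  K1+2*K2<= 2*d-1 /\ C0=C1+1 /\ kap = K1+1 /\ (M=K1 \/ 2*M<=d+1).

(** Here 2*d+M = C1, so (d, d, M) is just forbidden. The pair d, d is the only one for which the
    perimeter bounds exclude [M]; the top of its sum is M+1, which is the reason for the flag
    [tie]. *)
Definition boundsIIB := tie /\ K1 = K2 /\ M = K1 /\ C1 = 4*K1+1 /\ 3*K1 = 2*d-1 /\ C0 >= 4*K1+4 /\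
  kap = K1+1.

Definition bounds := 3 <= d /\ 1 <= K1 < d /\ K1 <= K2 /\ 2*d+4 <= C0 /\ 2*d+3 <= C1 /\
  K1 <= M <= K2 /\ d <= 2*M /\ M < d /\  2*M + d < C0 /\ 2*M+d < C1
  /\ (exists c0 c1, C0= 2*c0 /\ C1= 2*c1+1).

Hypothesis Hcom: bounds.
Hypothesis Hcase : boundsIII \/ boundsII \/ boundsIIB.
Ltac case_bounds := destruct Hcom as (Hd & HK1 & HK12 & HC0 & HC1 & HM1 & HM2 & HM3 & HM4 & HM5 &
  c0 & c1 & Hc0 & Hc1);
 destruct Hcase as [(Ht & Ha1 & Ha2 & Ha3 & Ha4 & Ha5 & Ha6 & Ha7 & Ha8 & Ha9)|[(Ht & Hb1 & Hb2 &
   Hb3 & Hb4 & Hb5 & Hb6 & Hb7)|(Ht & Hb1 & Hb2 & Hb3 & Hb4 & Hb5 & Hb6)]]; clear Hcom Hcase.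

(* The [below]-largest element [t] of the sum of [a] and of a set with largest element [m]. *)
Definition top_of a m t :=
  (a+m<M /\ t = a+m) \/ (a-m>M /\ t = a-m) \/ (m-a>M /\ t = m-a) \/
  (tie /\ a = d /\ m = d /\ t = M+1) \/ 
  (a+m>=M /\ -M <= a-m <= M /\ (C0-1-a-m>=M /\ C1-1-a-m >= M) /\ t = M) \/
  (~tie /\ a+m>=M /\ -M <= a-m <= M /\ (C0-1-a-m < M /\ C0 < C1) /\ t = C0-1-a-m) \/
  (~tie /\ a+m>=M /\ -M <= a-m <= M /\ (C1-1-a-m < M /\ C1 < C0) /\ t = C1-1-a-m).

Ltac parity p := let q := fresh "q" in let h := fresh "h" in destruct (Z.Even_or_Odd p) as [[q
  h]|[q h]].
Ltac destruct_top Htp := destruct Htp as [(t1&t2)|[(t1&t2)|[(t1&t2)|[(t1&t2&t3&t4)|[(t1&t2&(t3&t5)&t4)|[(t0&t1&t2&(t3&t5)&t4)|(t0&t1&t2&(t3&t5)&t4)]]]]]].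
Lemma top_tri a m t : 1<=a<=d -> 1<=m<=d -> top_of a m t -> 1<=t<=d /\ tri a m t.
Proof.
intros Ha Hm Htp. unfold top_of in Htp.
case_bounds; parity (a+m+t); destruct_top Htp; try contradiction; (split; [lia|]);
  first [apply (tri_even _ _ _ q); [lia|lia..] | apply (tri_odd _ _ _ q); [lia|lia..]].
Qed.

Lemma top_exists a m : 1<=a<=d -> 1<=m<=d -> exists t, top_of a m t.
Proof.
intros Ha Hm. unfold top_of.
destruct (Z_lt_ge_dec (a+m) M). exists (a+m); left; lia.
destruct (Z_lt_ge_dec M (a-m)). exists (a-m); right; left; repeat split; try lia; tauto.
destruct (Z_lt_ge_dec M (m-a)). exists (m-a); right; right; left; repeat split; try lia; tauto.
assert (D: tie /\ a = d /\ m = d \/ (C0-1-a-m>=M /\ C1-1-a-m >= M) \/ ~ tie /\ (C0-1-a-m < M /\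
  C0<C1 \/ C1-1-a-m < M /\ C1<C0)).
{ case_bounds. right; destruct (Z_lt_ge_dec (C0-1-a-m) M); destruct (Z_lt_ge_dec (C1-1-a-m) M);
  [right;split; [assumption|lia].. | left; lia].
 right; destruct (Z_lt_ge_dec (C0-1-a-m) M); destruct (Z_lt_ge_dec (C1-1-a-m) M); [right;split;
   [assumption|lia].. | left; lia].
 destruct (Z.eq_dec (a+m) (2*d)); [left; split; [assumption|lia] | right; left; lia]. }
destruct D as [D|[D|(D0&[D|D])]].
exists (M+1); right; right; right; left; tauto.
exists M; right; right; right; right; left; repeat split; try lia; tauto.
exists (C0-1-a-m); right; right; right; right; right; left; repeat split; try lia; tauto.
exists (C1-1-a-m); right; right; right; right; right; right; repeat split; try lia; tauto.
Qed.

Lemma top_below a m t x y : 1<=a<=d -> 1<=m<=d -> 0<=x<=d -> 0<=y<=d -> top_of a m t ->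
  below x m -> tri a x y -> below y t.
Proof.
intros Ha Hm Hx Hy Htp Hn (h1&h2&h3&h4).
apply below_cases in Hn as (r & Hr & Hn). unfold top_of in Htp.
case_bounds; parity (t-y);
(destruct h4 as [(p&h4&h5)|(p&h4&h5)]);
destruct_top Htp; try contradiction;
 try (rewrite t4; apply below_M);
(destruct Hn as [Hn|[(Hn&Hn')|[(Hn&Hn')|(Hn0&Hn&Hn')]]]);
try contradiction; try (exfalso; lia);
(first [apply below_low; [lia | first [left; exists q; lia | right; lia]] | apply below_high;
  [lia | first [left; exists q; lia | right; lia]] 
 | right; right; right; split; [assumption|]; split; [lia|exists q; lia] |
   destruct (Z_le_gt_dec y (M+1)); [right; right; right; split; [assumption|]; split;
   [lia|exists q; lia] | apply below_high; [lia | left; exists q; lia]]]).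
Qed.

Lemma below_toward_up x m : below x m -> x+2<=m -> below x (x+2) /\ below (x+2) m.
Proof.
clear Hcom Hcase.
intros [H|[(H1&H2)|[(H1&H2)|(H1&(H2&H3)&r&H4)]]] h.
- subst m; split; [apply below_low; [lia|left; exists 1; lia]|apply below_M].
- split; [apply below_low; [lia|left; exists 1; lia]|apply below_low; [lia|]].
  destruct H2 as [[r H2]|H2]; [left; exists (r-1); lia|right; left; assumption].
- lia.
- destruct (Z.eq_dec (x+2) (M+1)) as [e|e].
  + rewrite H3, e; split; right; right; right; (split; [assumption|]); (split; [lia|]);
      [exists 1|exists 0]; lia.
  + split; [apply below_low; [lia|left; exists 1; lia]| right; right; right; (split;
      [assumption|]); (split; [lia|])]. exists (r-1); lia.
Qed.

Lemma below_toward_down x m : below x m -> m+2<=x -> below x (x-2) /\ below (x-2) m.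
Proof.
clear Hcom Hcase.
intros [H|[(H1&H2)|[(H1&H2)|(H1&(H2&H3)&r&H4)]]] h.
- subst m; split; [apply below_high; [lia|left; exists (-1); lia]|apply below_M].
- lia.
- split; [apply below_high; [lia|left; exists (-1); lia]|apply below_high; [lia|]].
  destruct H2 as [[r H2]|H2]; [left; exists (r+1); lia|right; left; assumption].
- lia.
Qed.

Lemma below_refl x : below x x.
Proof.
destruct (Z_le_gt_dec x M); [apply below_low|apply below_high]; solve [lia|left; exists 0; lia].
Qed.

(* Contains every covering pair of [below]. *)
Definition cover y c := (y<c<=M /\ (c=y+2 \/ c=y+1 /\ (kap<=c \/ c=M))) \/ (M<=c<y /\ (c=y-2 \/
  c=y-1 /\ (c<K2 \/ c=M))) \/ (tie /\ y=M-1 /\ c=M+1).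

(** * Upward closure of sums, one covering step at a time *)

Ltac split_hyps := repeat match goal with H : _ /\ _ |- _ => destruct H | H : _ \/
  _ |- _ => lazymatch type of H with boundsIII \/ _ => fail | _ => destruct H end end.
Ltac try_between x m D k2 k2' k1 k1' := 
 (destruct (Z_le_gt_dec (x+2) m) as [?e|?e]; [apply (D (x+2));
   [tauto|k2] |destruct (Z_le_gt_dec (m+2) x) as [?f|?f]; [apply (D (x-2)); [tauto|k2']|
   apply (D m); [tauto|]; assert (m=x-1 \/ m = x+1 \/ m=x) as [?g|[?g|?g]] by lia; [k1' | k1 |
   exfalso]]]).
Ltac even_by q := apply (tri_even _ _ _ q).
Ltac odd_by q := apply (tri_odd _ _ _ q).

(** When [c] replaces its predecessor in the sum, [x] is kept if possible; otherwise it moves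
    towards [m] by 2, or to [m] itself when [m] is at distance at most 1. These candidates suffice
    for all covering steps. *)
Lemma closure_candidate a m x c : 1<=m<=d -> 0<=x<=d -> below x m ->
  forall z, z = x \/ z=m \/ x+2<=m/\z=x+2 \/ m+2<=x/\z=x-2 -> tri a z c -> exists z, 0<=z<=d /\
    below x z /\ below z m /\ tri a z c.
Proof.
intros Hm Hx Hn z Hz H; exists z. destruct Hz as [Hz|[Hz|[[h Hz]|[h Hz]]]]; subst z; (split;
  [clear Hcom Hcase; lia|]).
- split; [apply below_refl|tauto].
- split; [tauto|split; [apply below_refl|tauto]].
- destruct (below_toward_up _ _ Hn h); tauto.
- destruct (below_toward_down _ _ Hn h); tauto.
Qed.

Lemma closure_step_low a m x y c : 1<=a<=d -> 1<=m<=d -> 0<=x<=d -> 0<=y -> y<c<=M -> c<=a+m ->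
  c<=C0-1-a-m -> c<= C1-1-a-m -> -M<=a-m<=M ->
  tri a x y -> below x m -> c=y+2 \/ c=y+1 /\ (kap<=c\/c=M) -> exists z, 0<=z<=d /\ below x z /\
    below z m /\ tri a z c.
Proof.
intros Ha Hm Hx Hy Hc c1' c2' c3' c4' Ht Hn Hk.
pose proof (closure_candidate a m x c Hm Hx Hn) as D.
apply below_cases in Hn. destruct Hn as (r & Hr & Hn).
destruct Ht as (h1&h2&h3&h4).
destruct h4 as [(q&h4&h5)|(q&h4&h5)]; destruct Hk as [Hk|[Hk Hk']].
- destruct (tri_even_or a x c (q+1)) as [D'|D']; [clear -h4 Hk; lia|apply (D x);tauto|].
  clear Hr. destruct D' as [D'|[D'|[D'|D']]]; try (exfalso; clear -h1 h2 h3 D' Hk Hc; lia);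
    case_bounds; split_hyps; try (exfalso; lia).
  all: try_between x m D ltac:(even_by (q+2)) ltac:(even_by q) ltac:(odd_by (q+1)) ltac:(odd_by q);
    lia.
- destruct (tri_odd_or a x c q) as [D'|D']; [clear -h4 Hk; lia|apply (D x);tauto|].
  clear Hr. repeat (destruct D' as [D'|D']); try (exfalso; clear -h1 h2 h3 D' Hk Hc h5; lia);
    case_bounds; split_hyps; try (exfalso; lia).
  all: try_between x m D ltac:(odd_by (q+1)) ltac:(odd_by (q-1)) ltac:(even_by (q+1)) ltac:(even_by
    q); lia.
- destruct (tri_odd_or a x c (q+1)) as [D'|D']; [clear -h4 Hk; lia|apply (D x);tauto|].
  clear Hr. repeat (destruct D' as [D'|D']); try (exfalso; clear -h1 h2 h3 D' Hk Hc h5; lia);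
    case_bounds; split_hyps; try (exfalso; lia).
  all: try_between x m D ltac:(odd_by (q+2)) ltac:(odd_by q) ltac:(even_by (q+2)) ltac:(even_by
    (q+1)); lia.
- destruct (tri_even_or a x c (q+1)) as [D'|D']; [clear -h4 Hk; lia|apply (D x);tauto|].
  clear Hr. repeat (destruct D' as [D'|D']); try (exfalso; clear -h1 h2 h3 D' Hk Hc h5; lia);
    case_bounds; split_hyps; try (exfalso; lia).
  all: try_between x m D ltac:(even_by (q+2)) ltac:(even_by q) ltac:(odd_by (q+1)) ltac:(odd_by q);
    lia.
Qed.

Lemma closure_step_high a m x y c : 1<=a<=d -> 1<=m<=d -> 0<=x<=d -> 0<=y -> y<=d -> M<=c<y ->
  c>=a-m -> c>=m-a -> a+m>=M -> C0-1-a-m>=M -> C1-1-a-m>=M ->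
  tri a x y -> below x m -> c=y-2 \/ c=y-1 /\ (c<K2\/c=M) -> exists z, 0<=z<=d /\ below x z /\
    below z m /\ tri a z c.
Proof.
intros Ha Hm Hx Hy Hyd Hc c1' c2' c3' c4' c5' Ht Hn Hk.
pose proof (closure_candidate a m x c Hm Hx Hn) as D.
apply below_cases in Hn. destruct Hn as (r & Hr & Hn).
destruct Ht as (h1&h2&h3&h4).
destruct h4 as [(q&h4&h5)|(q&h4&h5)]; destruct Hk as [Hk|[Hk Hk']].
- destruct (tri_even_or a x c (q-1)) as [D'|D']; [clear -h4 Hk; lia|apply (D x);tauto|].
  clear Hr. repeat (destruct D' as [D'|D']); try (exfalso; clear -h1 h2 h3 D' Hk Hc h5; lia);
    case_bounds; split_hyps; try (exfalso; lia).
  all: try_between x m D ltac:(even_by q) ltac:(even_by (q-2)) ltac:(odd_by (q-1)) ltac:(odd_by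
    (q-2)); lia.
- destruct (tri_odd_or a x c (q-1)) as [D'|D']; [clear -h4 Hk; lia|apply (D x);tauto|].
  clear Hr. repeat (destruct D' as [D'|D']); try (exfalso; clear -h1 h2 h3 D' Hk Hc h5; lia);
    case_bounds; split_hyps; try (exfalso; lia).
  all: try_between x m D ltac:(odd_by q) ltac:(odd_by (q-2)) ltac:(even_by q) ltac:(even_by (q-1));
    lia.
- destruct (tri_odd_or a x c (q-1)) as [D'|D']; [clear -h4 Hk; lia|apply (D x);tauto|].
  clear Hr. repeat (destruct D' as [D'|D']); try (exfalso; clear -h1 h2 h3 D' Hk Hc h5; lia);
    case_bounds; split_hyps; try (exfalso; lia).
  all: try_between x m D ltac:(odd_by q) ltac:(odd_by (q-2)) ltac:(even_by q) ltac:(even_by (q-1));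
    lia.
- destruct (tri_even_or a x c q) as [D'|D']; [clear -h4 Hk; lia|apply (D x);tauto|].
  clear Hr. repeat (destruct D' as [D'|D']); try (exfalso; clear -h1 h2 h3 D' Hk Hc h5; lia);
    case_bounds; split_hyps; try (exfalso; lia).
  all: try_between x m D ltac:(even_by (q+1)) ltac:(even_by (q-1)) ltac:(odd_by q) ltac:(odd_by
    (q-1)); lia.
Qed.

Lemma tie_top x : tie -> below x d -> 0<=x<=d -> x = d.
Proof.
intros ht Hn Hx. apply below_cases in Hn as (r & Hr & Hn).
case_bounds; split_hyps; try contradiction; lia.
Qed.

Lemma closure_step_tie a m x y c : 1<=a<=d -> 1<=m<=d -> 0<=x<=d -> 0<=y<=d -> tie -> y = M-1 ->
  c = M+1 -> -M <= a-m <= M -> a+m >= M -> a+m < 2*d ->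
  tri a x y -> below x m -> exists z, 0<=z<=d /\ below x z /\ below z m /\ tri a z c.
Proof.
intros Ha Hm Hx Hy ht Hk Hk' c1' c2' c3' Ht Hn.
pose proof (closure_candidate a m x c Hm Hx Hn) as D.
apply below_cases in Hn. destruct Hn as (r & Hr & Hn).
destruct Ht as (h1&h2&h3&h4).
destruct h4 as [(q&h4&h5)|(q&h4&h5)].
- destruct (tri_even_or a x c (q+1)) as [D'|D']; [clear -h4 Hk Hk'; lia|apply (D x);tauto|].
  clear Hr. repeat (destruct D' as [D'|D']); try (exfalso; clear -h1 h2 h3 D' Hk Hk' h5; lia);
    case_bounds; try contradiction; split_hyps; try (exfalso; lia).
  all: try_between x m D ltac:(even_by (q+2)) ltac:(even_by q) ltac:(odd_by (q+1)) ltac:(odd_by q);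
    lia.
- destruct (tri_odd_or a x c (q+1)) as [D'|D']; [clear -h4 Hk Hk'; lia|apply (D x);tauto|].
  clear Hr. repeat (destruct D' as [D'|D']); try (exfalso; clear -h1 h2 h3 D' Hk Hk' h5; lia);
    case_bounds; try contradiction; split_hyps; try (exfalso; lia).
  all: try_between x m D ltac:(odd_by (q+2)) ltac:(odd_by q) ltac:(even_by (q+2)) ltac:(even_by
    (q+1)); lia.
Qed.

Lemma closure_step a m t x y c : 1<=a<=d -> 1<=m<=d -> 0<=x<=d -> 0<=y<=d -> top_of a m t ->
  tri a x y -> below x m -> below y t -> cover y c -> below c t ->
  exists z, 0<=z<=d /\ below x z /\ below z m /\ tri a z c.
Proof.
intros Ha Hm Hx Hy Htp Htr Hn Hyt Hcov Hct.
assert (K: (tie /\ a = d /\ m = d) \/ ~ (tie /\ a = d /\ m = d)).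
{ case_bounds; [right; tauto|right;tauto|].
destruct (Z.eq_dec a d); destruct (Z.eq_dec m d); tauto. }
destruct K as [(K & Ka & Km)|K].
(* Only [d] lies below [d] here, so [x] cannot move. As [M] is odd, the labels below M+1 are even,
   and for these the triangle with sides d, d is allowed. *)
- subst a m. assert (x = d) by (apply tie_top; tauto). subst x.
  exists d; split; [lia|]. split; [apply below_refl|]. split; [apply below_refl|].
  assert (t = M+1) by (case_bounds; try contradiction; destruct_top Htp; try contradiction;
    try lia).
  subst t. apply below_cases in Hyt as (r & Hr & Hyt). apply below_cases in Hct as (r' & Hr' & Hct).
  destruct Htr as (h1&h2&h3&h4). parity c.
  + apply (tri_even _ _ _ (d+q)); destruct h4 as [(p&h4&h5)|(p&h4&h5)]; case_bounds;
      try contradiction; destruct Hcov as [Hv|[Hv|Hv]]; lia.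
  + exfalso. destruct h4 as [(p&h4&h5)|(p&h4&h5)]; case_bounds; try contradiction;
      clear Htp Hr Hr' Hyt Hcov; split_hyps; try contradiction; lia.
- apply below_cases in Hyt as (r & Hr & Hyt). apply below_cases in Hct as (r' & Hr' & Hct).
  assert (HM : 2*M+d<C0 /\ 2*M+d<C1 /\ d<= 2*M) by (clear Hcase;
    destruct Hcom as (_&_&_&_&_&_&hm1&_&hm2&hm3&_); auto).
  assert (Y : t = a - m \/ t = m - a -> t > M -> y >= t).
  { intros e1 e2. apply below_cases in Hn as (r1 & Hr1 & Hn). destruct Htr as (h1&h2&h3&_).
    clear -HM Ha Hm Hx Hy e1 e2 Hn h1 h2 h3. destruct e1; destruct Hn as [Hn|[Hn|[Hn|Hn]]]; lia. }
  destruct Hcov as [Hv|[Hv|Hv]].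
  + assert (B : c<=a+m /\ c<=C0-1-a-m /\ c<= C1-1-a-m /\ -M<=a-m<=M).
    { clear Hcom Hcase Hr Hr' Hyt Hn Htr; destruct_top Htp; destruct Hct as
      [Hct|[Hct|[Hct|(Hct0&Hct&Hct1)]]]; try contradiction; try lia; tauto. }
    apply (closure_step_low a m x y c); try assumption; lia.
  + assert (B : c>=a-m /\ c>=m-a /\ a+m>=M /\ C0-1-a-m>=M /\ C1-1-a-m>=M).
    { clear Hcom Hcase Hr Hr' Hyt Hn Htr; destruct_top Htp; destruct Hct as
      [Hct|[Hct|[Hct|(Hct0&Hct&Hct1)]]]; try contradiction; try lia; tauto. }
    apply (closure_step_high a m x y c); try assumption; lia.
  + destruct Hv as (Hv0&Hv1&Hv2).
    assert (B : -M<=a-m<=M /\ a+m>=M).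
    { clear Hcom Hcase Hr Hr' Hyt Hn Htr; destruct_top Htp; destruct Hct as
      [Hct|[Hct|[Hct|(Hct0&Hct&Hct1)]]]; try contradiction; try lia; tauto. }
    assert (R : a+m<2*d) by (destruct (Z.eq_dec a d); destruct (Z.eq_dec m d); lia || tauto).
    apply (closure_step_tie a m x y c); try assumption; lia.
Qed.

(** * The tree order *)

Lemma tie_bounds : tie -> kap = M+1 /\ K2 = M.
Proof. intros ht. case_bounds; try contradiction; lia. Qed.

Lemma tie_odd : tie -> exists q, M= 2*q+1.
Proof. intros ht. case_bounds; try contradiction; parity M; exists q; lia. Qed.

Lemma kap_ge : K1 <= kap. Proof. case_bounds; lia. Qed.

Ltac solve_below q := solve [apply below_M
  | apply below_low; [lia | first [left; exists q; lia | left; exists (q+1); lia | right; left;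
    lia]]
  | apply below_high; [lia | first [left; exists q; lia | left; exists (q+1); lia | right; left;
    lia]]
  | right; right; right; split; [assumption|split;[lia|first [exists q; lia|exists (q+1); lia]]]].
Lemma below_trans x y z : below x y -> below y z -> below x z.
Proof.
pose proof tie_bounds as TK; pose proof tie_odd as TO; clear Hcom Hcase. intros H1 H2.
apply below_cases in H1 as (r & Hr & H1). apply below_cases in H2 as (r' & Hr' & H2).
destruct H2 as [H2|[(H2&H2')|[(H2&H2')|(t2&H2&H2')]]]; [subst z; apply below_M|..];
destruct H1 as [H1|[(H1&H1')|[(H1&H1')|(t1&H1&H1')]]]; try (exfalso; lia);
try (destruct (TK t2) as [TK1 TK2]; destruct (TO t2) as [q0 TO1]);
  try (destruct (TK t1) as [TK1 TK2]; destruct (TO t1) as [q0 TO1]); clear TK TO; try (exfalso;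
  lia);
destruct Hr as [Hr|Hr]; destruct Hr' as [Hr'|Hr']; first [solve_below (r+r')].
Qed.

(** Together with transitivity this makes [below] a tree order; it is the property behind
    [good_helly]. *)
Lemma below_chain x c c' : below x c -> below x c' -> below c c' \/ below c' c.
Proof.
pose proof tie_bounds as TK; pose proof tie_odd as TO; clear Hcom Hcase. intros H1 H2.
apply below_cases in H1 as (r & Hr & H1). apply below_cases in H2 as (r' & Hr' & H2).
destruct H2 as [H2|[(H2&H2')|[(H2&H2')|(t2&H2&H2')]]]; [subst c'; left; apply below_M|..];
destruct H1 as [H1|[(H1&H1')|[(H1&H1')|(t1&H1&H1')]]]; try (subst c; right; apply below_M);
  try (exfalso; lia);
try (destruct (TK t2) as [TK1 TK2]; destruct (TO t2) as [q0 TO1]);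
  try (destruct (TK t1) as [TK1 TK2]; destruct (TO t1) as [q0 TO1]); clear TK TO; try (exfalso;
  lia);
destruct Hr as [Hr|Hr]; destruct Hr' as [Hr'|Hr']; destruct (Z_lt_ge_dec c c'); first [left;
  solve_below (r'-r) | left; solve_below (r'-r-1) | right; solve_below (r-r') | right;
  solve_below (r-r'-1)].
Qed.

Lemma below_anti x c : below x c -> below c x -> x = c.
Proof.
clear Hcom Hcase. intros H1 H2. apply below_cases in H1 as (r & Hr & H1).
apply below_cases in H2 as (r' & Hr' & H2).
destruct H2 as [H2|[(H2&H2')|[(H2&H2')|(t2&H2&H2')]]]; destruct H1 as
  [H1|[(H1&H1')|[(H1&H1')|(t1&H1&H1')]]]; lia.
Qed.

(** Reduces [closure] to covering steps. Each step can be chosen to decrease the absolute difference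
    to [c], which serves as induction measure. *)
Lemma below_path y c : below y c -> y <> c -> exists y', cover y y' /\ below y' c /\
  Z.abs (c-y') < Z.abs (c-y) .
Proof.
intros H e. pose proof tie_bounds as TK; pose proof tie_odd as TO; pose proof kap_ge as KB;
  clear Hcom Hcase.
apply below_cases in H as (r & Hr & H). 
destruct H as [H|[(H&H')|[(H&H')|(t1&H&H')]]].
- subst c. destruct (Z_lt_ge_dec y (M-1)) as [l|l]; [exists (y+2)|destruct (Z_lt_ge_dec y M) as
    [l2|l2]; [exists (y+1)|destruct (Z_lt_ge_dec (M+1) y) as [l3|l3];
    [exists (y-2)|exists (y-1)]]]; (split; [|split; [apply below_M|lia]]);
  [left; lia|left; lia|right;left; lia|right; left; lia].
- destruct Hr as [Hr|Hr]; destruct (Z_lt_ge_dec (y+1) c) as [l|l].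
  all: first [exists (y+2); split; [left; lia|split; [|lia]]; solve_below (r-1) | exists (y+1);
    split; [left; lia|split; [|lia]]; solve_below 0].
- destruct Hr as [Hr|Hr]; destruct (Z_lt_ge_dec c (y-1)) as [l|l].
  all: first [exists (y-2); split; [right; left; lia|split; [|lia]]; solve_below (r+1) |
    exists (y-1); split; [right; left; lia|split; [|lia]]; solve_below 0].
- destruct (TO t1) as [q0 TO1]. destruct (Z_lt_ge_dec y (M-1)) as [l|l].
  + exists (y+2); split; [left; lia|split; [|lia]]. solve_below (r-1).
  + exists (M+1); split; [right; right; split; [assumption|lia]|split; [|lia]]. solve_below 0.
Qed.

(** Induction along a path of covering steps from [y] to [c]: each step replaces [x] by a label
    above it that is still below [m], so the steps can be chained. *)
Lemma closure a m t x y c : 1<=a<=d -> 1<=m<=d -> 0<=x<=d -> 0<=y<=d -> 0<=c<=d -> top_of a m t ->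
  tri a x y -> below x m -> below y c -> below c t ->
  exists z, 0<=z<=d /\ below x z /\ below z m /\ tri a z c.
Proof.
intros Ha Hm Hx Hy Hc Htp Htr Hn Hyc Hct.
remember (Z.to_nat (Z.abs (c-y))) as n eqn:En. revert x y Hx Hy Htr Hn Hyc En.
induction n as [n IH] using lt_wf_ind. intros x y Hx Hy Htr Hn Hyc En.
destruct (Z.eq_dec y c) as [e|e].
{ subst y. exists x. split; [lia|]. split; [apply below_refl|split; assumption]. }
destruct (below_path y c Hyc e) as (y' & Hcov & Hn' & Hlt).
destruct (closure_step a m t x y y') as (z & Hz & Hxz & Hzm & Hz'); try assumption.
{ apply (below_trans _ c); assumption. }
{ apply (below_trans _ c); assumption. }
destruct (IH (Z.to_nat (Z.abs (c-y'))) ltac:(lia) z y') as (z' & Hz0 & Hzz & Hzm' & Hz0');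
  try assumption; try lia.
{ destruct Hcov as [h|[h|h]]; lia. }
exists z'. split; [lia|]. split; [apply (below_trans _ z); assumption|tauto].
Qed.

(** * Special triangles, and substitutes for the distances 1 and delta *)

Lemma tri_aa2 a : 1<=a<=d -> tri a a 2.
Proof. intros. case_bounds; apply (tri_even _ _ _ (a+1)); lia. Qed.

Lemma tri_2up e q : 0<=e -> e = 2*q -> e+2<=d -> tri 2 e (e+2).
Proof. intros. case_bounds; apply (tri_even _ _ _ (e+2)); lia. Qed.

Lemma tri_M_around q : M = 2*q+1 -> 3 <= M -> tri (M-1) (M+1) M.
Proof. intros. case_bounds; apply (tri_odd _ _ _ (3*q+1)); split_hyps; try lia. Qed.

Lemma tri_MM j : 0<=j<=d -> tri M M j.
Proof. intros. parity j; [apply (tri_even _ _ _ (M+q))|apply (tri_odd _ _ _ (M+q))]; case_bounds;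
split_hyps; lia. Qed.

Lemma M_ge2 : 2 <= M. Proof. case_bounds; lia. Qed.

(** Here [x], [y] are the distances of one point to the ends of an edge of length 1, [x'], [y']
    those of another point, and [z] is the distance of the two points. If the first point forbids
    length 2, every point admits length 3; hence one of 2 and 3 suits all points at once. *)
Lemma avoid_one x y x' y' z : 1<=x<=d -> 1<=y<=d -> 1<=x'<=d -> 1<=y'<=d -> 0<=z<=d -> tri x y 1 ->
  tri x' y' 1 -> tri x x' z -> tri y y' z ->
  tri x y 2 \/ (3 < d /\ tri x' y' 3).
Proof.
intros hx hy hx' hy' hz (a1&a2&a3&[(q&a4&a5)|(q&a4&a5)]) (b1&b2&b3&[(p&b4&b5)|(p&b4&b5)])
  (f1&f2&f3&f4) (e1&e2&e3&e4).
- destruct (tri_odd_or x y 2 q) as [D|D]; [lia|tauto|right].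
  assert (3 < d) by (repeat (destruct D as [D|D]); case_bounds; split_hyps; try lia).
  split; [assumption|].
  apply (tri_even _ _ _ (p+1)); case_bounds; lia.
- destruct (tri_odd_or x y 2 q) as [D|D]; [lia|tauto|right].
  assert (3 < d) by (repeat (destruct D as [D|D]); case_bounds; split_hyps; try lia).
  split; [assumption|].
  destruct f4 as [(r&f4&f5)|(r&f4&f5)]; destruct e4 as [(r'&e4&e5)|(r'&e4&e5)];
    apply (tri_odd _ _ _ (p+1)); repeat (destruct D as [D|D]); case_bounds; split_hyps; lia.
- left. apply (tri_even _ _ _ (q+1)); case_bounds; lia.
- left. apply (tri_even _ _ _ (q+1)); case_bounds; lia.
Qed.

(** Subtracting 2 keeps the parity of the perimeter. If K2 >= d, the bound 2*K2+2*m on odd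
    perimeters does not bind and d-1 serves. For d = 3 and K2 < d, d-2 would be the other extreme
    distance 1, and 2 is taken. *)
Lemma avoid_delta : exists t, 2<=t<=d-1 /\ forall x y, 1<=x<=d -> 1<=y<=d -> tri x y d -> tri x y t.
Proof.
assert (Hd : 3 <= d) by (clear Hcase; destruct Hcom; assumption).
assert (H : (K2 < d /\ 4<=d) \/ (K2>=d) \/ (d = 3 /\ K2 < d)) by (clear Hcom Hcase; lia).
destruct H as [H|[H|H]]; [exists (d-2)|exists (d-1)|exists 2]; (split; [lia|]);
  intros x y hx hy (a1&a2&a3&[(q&a4&a5)|(q&a4&a5)]); clear Hd.
- apply (tri_even _ _ _ (q-1)); case_bounds; split_hyps; lia.
- apply (tri_odd _ _ _ (q-1)); case_bounds; split_hyps; lia.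
- apply (tri_odd _ _ _ (q-1)); case_bounds; split_hyps; lia.
- apply (tri_even _ _ _ q); case_bounds; split_hyps; lia.
- apply (tri_odd _ _ _ (q-1)); case_bounds; split_hyps; lia.
- apply (tri_even _ _ _ q); case_bounds; split_hyps; lia.
Qed.

(** * Associativity and the Helly property *)

Ltac destruct_top_fresh Htp := destruct Htp as [(?t1&?t2)|[(?t1&?t2)|[(?t1&?t2)|[(?t1&?t2&?t3&?t4)|[(?t1&?t2&(?t3&?t5)&?t4)|[(?t0&?t1&?t2&(?t3&?t5)&?t4)|(?t0&?t1&?t2&(?t3&?t5)&?t4)]]]]]].
(** The label [f] must lie in the sum of [b], [c] and in the sum of [a], [g]. It is enough to try
    the tops [t] and [u] of these two sums. *)
Lemma tri_assoc a b c g e : 1<=a<=d -> 1<=b<=d -> 1<=c<=d -> 1<=g<=d -> 0<=e<=d -> tri a b e ->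
  tri e c g ->
  exists f, 0<=f<=d /\ tri b c f /\ tri a f g.
Proof.
intros Ha Hb Hc Hg He T1 T2.
destruct (top_exists b c) as [t H1]; [assumption..|].
destruct (top_exists a g) as [u H2]; [assumption..|].
destruct (top_tri b c t) as [Htt R1]; [assumption..|].
destruct (top_tri a g u) as [Huu R2]; [assumption..|].
assert (D : tri a t g \/ tri b c u); [|destruct D as [D|D]; [exists t|exists u]; (split; [lia|]);
  (split; [assumption|])].
2: assumption. 
2: clear -R2; destruct R2 as (h1&h2&h3&[(q&h4&h5)|(q&h4&h5)]);
  [apply (tri_even _ _ _ q)|apply (tri_odd _ _ _ q)]; lia.
clear R1 R2.
destruct T1 as (k1&k2&k3&k4). destruct T2 as (l1&l2&l3&l4).
parity (a+t+g).
- destruct (tri_even_or a t g q h) as [D|D]; [left; assumption|].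
  destruct k4 as [(p1&k4&k5)|(p1&k4&k5)]; destruct l4 as [(p2&l4&l5)|(p2&l4&l5)];
  destruct_top H1; destruct D as [D|[D|[D|D]]]; try (exfalso; clear Hcom Hcase H2; lia).
  all: case_bounds; try contradiction; revert H2; split_hyps; try (exfalso; lia).
  all: let X := fresh "X" in intro X; destruct_top_fresh X; try contradiction; try (exfalso; lia).
  all: right; let q := fresh in let h:=fresh in destruct (Z.Even_or_Odd (b+c+u)) as [[q h]|[q h]];
    [apply (tri_even _ _ _ q)|apply (tri_odd _ _ _ q)]; lia.
- destruct (tri_odd_or a t g q h) as [D|D]; [left; assumption|].
  destruct k4 as [(p1&k4&k5)|(p1&k4&k5)]; destruct l4 as [(p2&l4&l5)|(p2&l4&l5)];
  destruct_top H1; repeat (destruct D as [D|D]); try (exfalso; clear Hcom Hcase H2; lia).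
  all: case_bounds; try contradiction; revert H2; split_hyps; try (exfalso; lia).
  all: let X := fresh "X" in intro X; destruct_top_fresh X; try contradiction; try (exfalso; lia).
  all: right; let q := fresh in let h:=fresh in destruct (Z.Even_or_Odd (b+c+u)) as [[q h]|[q h]];
    [apply (tri_even _ _ _ q)|apply (tri_odd _ _ _ q)]; lia.
Qed.

(* The sets of labels that arise as sums along a walk. *)
Definition good (T : Z -> Prop) := exists m, 1<=m<=d /\ T m /\ (forall x, T x -> 0<=x<=d /\
  below x m) /\
  (forall x c, T x -> 0<=c<=d -> below x c -> below c m -> T c).
Lemma good_single a : 1<=a<=d -> good (fun x => x = a).
Proof.
intros Ha; exists a; split; [lia|split; [reflexivity|split]].
- intros x ->; split; [lia|apply below_refl].
- intros x c -> _ H1 H2; symmetry; apply below_anti; assumption.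
Qed.

Lemma good_add a T : 1<=a<=d -> good T -> good (fun c => 0<=c<=d /\ exists x, T x /\ tri a x c).
Proof.
intros Ha (m & Hm & Tm & T1 & T2).
destruct (top_exists a m) as [t Ht]; [assumption..|].
destruct (top_tri a m t) as [Ht1 Ht2]; [assumption..|].
exists t; split; [assumption|split; [split; [lia|exists m; tauto]|split]].
- intros y (Hy & x & Tx & Hxy). destruct (T1 x Tx) as [Hx Hn]. split; [assumption|].
  apply (top_below a m t x y); assumption.
- intros y c (Hy & x & Tx & Hxy) Hc Hyc Hct. destruct (T1 x Tx) as [Hx Hn]. split; [assumption|].
  destruct (closure a m t x y c) as (z & Hz & Hxz & Hzm & Hzc); try assumption.
  exists z; split; [apply (T2 x); assumption|assumption].
Qed.

(** A numerical measure of the depth in the tree. The shift by 1 against the factor 4 makes M+1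
    count as closer to the root than M-1, as the flag [tie] demands. *)
Lemma below_rank x c : below x c -> x <> c -> Z.abs (4*c-(4*M+1)) < Z.abs (4*x-(4*M+1)).
Proof.
clear Hcom Hcase. intros H e. apply below_cases in H as (r & Hr & [H|[(H&_)|[(H&_)|(_&H&H')]]]);
  lia.
Qed.

Lemma max_rank (Q : Z -> Prop) (f : Z -> Z) B m : (forall m, Q m -> f m <= B) -> Q m -> exists m0,
  Q m0 /\ forall m', Q m' -> f m' <= f m0.
Proof.
clear Hcom Hcase. intros HB Hm. remember (Z.to_nat (B - f m)) as n eqn:En. revert m Hm En.
induction n as [n IH] using lt_wf_ind; intros m Hm En.
destruct (classic (exists m', Q m' /\ f m < f m')) as [(m' & Hm' & Hlt)|H].
- apply (IH (Z.to_nat (B - f m')) ltac:(specialize (HB m' Hm'); lia) m' Hm' eq_refl).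
- exists m; split; [assumption|]. intros m' Hm'. destruct (Z_lt_ge_dec (f m) (f m')); [|lia].
  exfalso; apply H; exists m'; tauto.
Qed.

(** Among the tops of all members choose [m0] of greatest rank, that is, deepest in the tree. Any
    member [T] shares some [x] with the set of [m0]; both tops lie above [x], hence are comparable,
    and by the choice of [m0] the top of [T] is the upper one. Closure of [T] upwards from [x] then
    puts [m0] into [T]. *)
Lemma good_helly (F : (Z -> Prop) -> Prop) : (forall T, F T -> good T) -> (forall T T', F T ->
  F T' -> exists x, T x /\ T' x) ->
  exists c, 1<=c<=d /\ forall T, F T -> T c.
Proof.
intros HF Hint.
pose (Q := fun m => 1<=m<=d /\ exists T, F T /\ T m /\ (forall x, T x -> 0<=x<=d /\ below x m) /\
  (forall x c, T x -> 0<=c<=d -> below x c -> below c m -> T c)).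
destruct (classic (exists m, Q m)) as [(m & Hm)|H].
- destruct (max_rank Q (fun c => Z.abs (4*c-(4*M+1))) (4*d+Z.abs(4*M+1)) m) as (m0 & Hm0 & Hmax);
    [|assumption|].
  { intros m' [Hm' _]. lia. }
  destruct Hm0 as (Hm0 & T0 & F0 & T0m & T0a & T0b).
  exists m0; split; [assumption|]. intros T HT.
  destruct (HF T HT) as (m1 & Hm1 & Tm1 & Ta & Tb).
  destruct (Hint T T0 HT F0) as (x & Tx & T0x).
  destruct (Ta x Tx) as [Hx Hxm1]. destruct (T0a x T0x) as [_ Hxm0].
  assert (Hmm : below m0 m1).
  { destruct (below_chain x m0 m1 Hxm0 Hxm1) as [h|h]; [assumption|].
    destruct (Z.eq_dec m1 m0) as [e|e]; [rewrite e; apply below_refl|].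
    apply below_rank in h; [|assumption].
    specialize (Hmax m1 (conj Hm1 (ex_intro _ T (conj HT (conj Tm1 (conj Ta Tb)))))). lia. }
  apply (Tb x); [assumption|lia|assumption|assumption].
- exists M. split; [case_bounds; lia|]. intros T HT. exfalso; apply H.
  destruct (HF T HT) as (m1 & Hm1 & Tm1 & Ta & Tb). exists m1; split; [assumption|].
  exists T; tauto.
Qed.
End AllowedTriangles.

Require Import Defs.
From mathcomp Require Import all_boot zify.
Set Implicit Arguments.
Unset Strict Implicit.
Unset Printing Implicit Defensive.

(** * The Hales-Jewett theorem *)

Section HalesJewett.
Variable T : finType.
Definition line_at (I : finType) (w : {ffun I -> option T}) (x : T) : {ffun I -> T} :=
  [ffun i => odflt x (w i)].
Definition is_line (I : finType) (w : {ffun I -> option T}) : Prop := exists i, w i = None.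

Definition glue (I J : finType) (S : Type) (f : I -> S) (g : J -> S) : I + J -> S :=
  fun k => match k with inl i => f i | inr j => g j end.

Definition focused (I K : finType) (C : {ffun I -> T} -> K) (s : seq T) (a x0 : T) (f : {ffun I ->
  T})
   (ls : seq {ffun I -> option T}) : Prop :=
  (forall l, l \in ls -> [/\ is_line l, line_at l a = f & forall x, x \in s ->
    C (line_at l x) = C (line_at l x0)]) /\
  uniq [seq C (line_at l x0) | l <- ls].

Definition mono_line (I K : finType) (C : {ffun I -> T} -> K) (s : seq T) : Prop :=
  exists2 l, is_line l & forall x y, x \in s -> y \in s -> C (line_at l x) = C (line_at l y).

(** Induction on the alphabet [s] by colour focusing: as long as no monochromatic line for the
    larger alphabet appears, there are arbitrarily many lines through a common point at the new
    letter [a], with pairwise different colours on the old letters. More than [#|K|] of them cannot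
    exist. *)
Lemma Hales_Jewett (s : seq T) (K : finType) :
  exists I : finType, forall C : {ffun I -> T} -> K, mono_line C s.
Proof.
elim: s K => [|a s IHs] K.
  exists unit => C; exists [ffun=> None] => //; by exists tt; rewrite ffunE.
case: s IHs => [|x0 s] IHs.
  exists unit => C; exists [ffun=> None]; first by exists tt; rewrite ffunE.
  by move=> x y; rewrite !inE => /eqP-> /eqP->.
set s1 := x0 :: s in IHs *.
suff key r : exists I : finType, forall C : {ffun I -> T} -> K,
    mono_line C (a :: s1) \/ exists f ls, size ls = r /\ focused C s1 a x0 f ls.
  have [I HI] := key #|K|.+1; exists I => C.
  case: (HI C) => // -[f [ls [sz [_ u]]]].
  by have := card_uniqP u; rewrite size_map sz => e; have := max_card [in [seq C (line_at l x0) |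
    l <- ls]]; rewrite e ltnn.
elim: r => [|r [I HI]].
  exists void => C; right; exists [ffun v : void => match v with end], [::]; split=> //; split=> //.
(* The smaller alphabet is applied with whole colourings of the [I]-cube as colours. Along the line
   [l'] the induced colouring [C'] is then the same for all old letters. *)
have [J HJ] := IHs {ffun {ffun I -> T} -> K}.
exists (I + J)%type => C.
have [l' [j0 lj0] Hl'] := HJ (fun v' => [ffun v : {ffun I -> T} => C [ffun k => glue v v' k]]).
pose C' (v : {ffun I -> T}) := C [ffun k => glue v (line_at l' x0) k].
have C'E (v : {ffun I -> T}) x : x \in s1 -> C [ffun k => glue v (line_at l' x) k] = C' v.
  move=> xs; have := Hl' x x0 xs (mem_head _ _) => /ffunP/(_ v); by rewrite !ffunE.
case: (HI C') => [[l [i0 li0] Hl]|[f [ls [sz [Hls u]]]]].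
  left; exists [ffun k => glue l (fun j => Some (line_at l' x0 j)) k].
    by exists (inl i0); rewrite ffunE.
  have E x : line_at [ffun k => glue l (fun j => Some (line_at l' x0 j)) k] x = [ffun k => glue
    (line_at l x) (line_at l' x0) k].
    by apply/ffunP => -[i|j]; rewrite !ffunE //= ffunE.
  by move=> x y xs ys; rewrite !E; apply: Hl.
(* If the focus [f] has the colour of some line, that line is monochromatic at [a] too. Otherwise
   the line constant [f] on [I] contributes a new colour, and all lines, continued by [l'], have a
   common new focus. *)
have [/mapP[l lls Cf]|nf] := boolP (C' f \in [seq C' (line_at l x0) | l <- ls]).
  have [[i0 li0] la Hl] := Hls l lls.
  left; exists [ffun k => glue l (fun j => Some (line_at l' x0 j)) k].
    by exists (inl i0); rewrite ffunE.
  have E x : C (line_at [ffun k => glue l (fun j => Some (line_at l' x0 j)) k] x) = C' (line_at l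
    x).
    by congr C; apply/ffunP => -[i|j]; rewrite !ffunE //= ffunE.
  suff H x : x \in a :: s1 -> C' (line_at l x) = C' f by move=> x y /H Hx /H Hy; rewrite !E Hx.
  by rewrite in_cons => /orP[/eqP->|/Hl ->]; rewrite ?la.
right; exists [ffun k => glue f (line_at l' a) k].
pose vl := [ffun k => glue (fun i => Some (f i)) l' k] : {ffun I + J -> option T}.
pose dl (l : {ffun I -> option T}) := [ffun k => glue l l' k] : {ffun I + J -> option T}.
have vE x : line_at vl x = [ffun k => glue f (line_at l' x) k].
  by apply/ffunP => -[i|j]; rewrite !ffunE //= ffunE.
have dE l x : line_at (dl l) x = [ffun k => glue (line_at l x) (line_at l' x) k].
  by apply/ffunP => -[i|j]; rewrite !ffunE //= ffunE.
exists (vl :: map dl ls); split; first by rewrite /= size_map sz.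
split=> [l|].
  rewrite in_cons => /orP[/eqP->|/mapP[l1 l1s ->]].
    split; first by exists (inr j0); rewrite ffunE.
      by rewrite vE.
    by move=> x xs; rewrite !vE !C'E ?mem_head.
  have [[i0 li0] la Hl] := Hls l1 l1s.
  split; first by exists (inl i0); rewrite ffunE.
    by rewrite dE la.
  by move=> x xs; rewrite !dE !C'E ?mem_head // Hl.
rewrite /= vE C'E ?mem_head // -map_comp.
have -> : map ((fun l => C (line_at l x0)) \o dl) ls = [seq C' (line_at l x0) | l <- ls].
  by apply: eq_map => l /=; rewrite dE C'E ?mem_head.
by rewrite nf.
Qed.
End HalesJewett.

(** * Ramsey's theorem *)

Lemma pigeonhole (T : eqType) (K : finType) (f : T -> K) (s : seq T) (b : nat) :
  #|K| * b < size s -> exists c, b < count (fun x => f x == c) s.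
Proof.
move=> sz; case: (pickP (fun c => b < count (fun x => f x == c) s)) => [c ?|no]; first by exists c.
suff : size s <= #|K| * b by rewrite leqNgt sz.
have -> : size s = \sum_c count (fun x => f x == c) s.
  elim: {sz no} s => [|x s IH] /=; first by rewrite big1.
  by rewrite big_split /= -IH (bigD1 (f x)) //= eqxx big1 => [|i]; rewrite // eq_sym => /negPf->.
rewrite -sum_nat_const; apply: leq_sum => c _; by rewrite leqNgt no.
Qed.

Lemma Ramsey_sets (K : finType) (a b : nat) : exists N, forall (T : finType) (X : {set T}) (chi :
  {set T} -> K),
  N <= #|X| -> exists Y : {set T}, [/\ Y \subset X, #|Y| = b &
   forall Z1 Z2 : {set T}, Z1 \subset Y -> #|Z1| = a -> Z2 \subset Y -> #|Z2| = a ->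
     chi Z1 = chi Z2].
Proof.
elim: a b => [|a IHa] b.
  exists b => T X chi hX; have [Y YX cY] : exists2 Y : {set T}, Y \subset X & #|Y| = b.
    have [s [us sz sX]] := card_geqP hX.
    exists [set x in s]; first by apply/subsetP => x; rewrite inE => /sX.
    by rewrite cardsE (card_uniqP us).
  by exists Y; split=> // Z1 Z2 _ /eqP; rewrite cards_eq0 => /eqP-> _ /eqP;
    rewrite cards_eq0 => /eqP->.
(* Prehomogeneous sequences: the colour of a set depends only on its first point. The pigeonhole
   principle for these colours finishes the proof. *)
pose pre m := exists N, forall (T : finType) (X : {set T}) (chi : {set T} -> K), N <= #|X| ->
  exists s : seq (T * K), [/\ uniq (unzip1 s), size s = m, {subset unzip1 s <= X} &
    forall s1 x c s2, s = s1 ++ (x, c) :: s2 -> forall Z : {set T}, Z \subset unzip1 s2 -> #|Z|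
      = a -> chi (x |: Z) = c].
have Hpre m : pre m.
  elim: m => [|m [N HN]]; first by exists 0 => T X chi _; exists [::]; split=> // -[].
  (* The additional [a] points guarantee an [a]-subset [Z0], whose colour is attached to [x]. *)
  have [N' HN'] := IHa (N + a).
  exists N'.+1 => T X chi hX.
  have /card_gt0P[x xX] : 0 < #|X| by apply: leq_trans hX.
  have hX' : N' <= #|X :\ x| by move: hX; rewrite (cardsD1 x) xX.
  have [Y [YX cY mY]] := HN' T (X :\ x) (fun Z => chi (x |: Z)) hX'.
  have [Z0 [sZ0 cZ0]] : exists Z0 : {set T}, Z0 \subset Y /\ #|Z0| = a.
    have hY : a <= #|Y| by rewrite cY leq_addl.
    have [s [us sz sX]] := card_geqP hY.
    exists [set x in s]; split; first by apply/subsetP => y; rewrite inE => /sX.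
    by rewrite cardsE (card_uniqP us).
  have hY : N <= #|Y| by rewrite cY leq_addr.
  have [s [us sz sY Hs]] := HN T Y chi hY.
  exists ((x, chi (x |: Z0)) :: s); split=> /=.
  - rewrite us andbT; apply/negP => /sY xY; by have := subsetP YX _ xY; rewrite !inE eqxx.
  - by rewrite sz.
  - move=> y; rewrite in_cons => /orP[/eqP-> //|/sY yY]; by have := subsetP YX _ yY;
      rewrite !inE => /andP[].
  - move=> [|z s1] x' c s2 /= [].
      move=> <- <- <- Z sZ cZ; apply: (mY Z Z0) => //; by apply: subset_trans sZ _;
        apply/subsetP => y /sY.
    by move=> _; apply: Hs.
have [N HN] := Hpre (#|K| * b).+1.
exists N => T X chi hX; have [s [us sz sX Hs]] := HN T X chi hX.
have [c hc] : exists c, b < count (fun p : T * K => p.2 == c) s by apply: pigeonhole; rewrite sz.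
pose s' := [seq p <- s | p.2 == c].
have us' : uniq (unzip1 s') by apply: subseq_uniq us; apply: map_subseq; apply: filter_subseq.
exists [set x in take b (unzip1 s')]; split.
- apply/subsetP => x; rewrite inE => /mem_take /mapP[p]; rewrite mem_filter => /andP[_ ps] ->;
    apply: sX; exact: map_f.
- by rewrite cardsE (card_uniqP (take_uniq b us')) size_takel // size_map size_filter ltnW.
suff H (Z : {set T}) : Z \subset [set x in take b (unzip1 s')] -> #|Z| = a.+1 ->
  chi Z = c by move=> Z1 Z2 h1 h2 h3 h4; rewrite !H.
move=> sZ cZ.
have {}sZ x : x \in Z -> x \in unzip1 s' by move/(subsetP sZ); rewrite inE => /mem_take.
have hasZ : has (fun p : T * K => p.1 \in Z) s.
  have /card_gt0P[x xZ] : 0 < #|Z| by rewrite cZ.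
  have /mapP[p] := sZ x xZ; rewrite mem_filter => /andP[_ ps] e; apply/hasP; exists p;
    by rewrite -?e.
have [x [c' [s1 [s2 [Es xZ nZ]]]]] : exists x c' s1 s2,
    [/\ s = s1 ++ (x, c') :: s2, x \in Z & ~~ has (fun p : T * K => p.1 \in Z) s1].
  by case: (split_find hasZ) => -[x c'] s1 s2 xZ nZ; exists x, c', s1, s2; rewrite cat_rcons.
have {Hs}H := Hs s1 x c' s2 Es.
have cc : c' = c.
  have /mapP[p] := sZ x xZ; rewrite mem_filter => /andP[/eqP pc ps] /= e.
  suff -> : c' = p.2 by [].
  move: ps us; rewrite Es e.
  rewrite mem_cat in_cons => /or3P[p1|/eqP -> //|p2].
  + by case/hasP: nZ; exists p => //; rewrite -e.
  + by rewrite /unzip1 map_cat cat_uniq /= => /and3P[_ _ /andP[]]; rewrite map_f.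
rewrite -(setD1K xZ) -cc; apply: H; last by move: cZ; rewrite (cardsD1 x) xZ => -[].
apply/subsetP => y; rewrite !inE => /andP[yx yZ].
have /mapP[p] := sZ y yZ; rewrite mem_filter => /andP[_ ps] /= e.
move: ps; rewrite Es mem_cat in_cons => /or3P[p1|/eqP pe|p2].
- by case/hasP: nZ; exists p => //; rewrite -e.
- by rewrite e pe eqxx in yx.
- by rewrite e map_f.
Qed.

(** * Sums of labels along walks *)

Definition compat (P : params) (a b c : nat) : bool :=
  [&& c <= a + b, a <= b + c, b <= a + c &
   if odd (a + b + c) then
     [&& 2 * K1 P < a + b + c, a + b + c < C1 P, b + c < 2 * K2 P + a,
       a + c < 2 * K2 P + b & a + b < 2 * K2 P + c]
   else a + b + c < C0 P].

Notation zn := Z.of_nat.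
Notation ztri P := (tri (zn (K1 P)) (zn (K2 P)) (zn (C0 P)) (zn (C1 P))).

Lemma compatP P a b c : compat P a b c <-> ztri P (zn a) (zn b) (zn c).
Proof.
rewrite /compat /tri; split.
  case/and4P => h1 h2 h3; case: ifP => ho.
    case/and5P => h4 h5 h6 h7 h8; do 3 (split; first lia); right; exists (zn (a + b + c)./2); lia.
  move=> h4; do 3 (split; first lia); left; exists (zn (a + b + c)./2); lia.
move=> [h1 [h2 [h3 [[q [h4 h5]]|[q [h4 h5]]]]]]; apply/and4P; split; try lia.
  by rewrite (_ : odd _ = false); lia.
by rewrite (_ : odd _ = true); [apply/and5P; split; lia | lia].
Qed.

Lemma compat_allowed P a b c : 0 < a -> 0 < b -> 0 < c ->
  compat P a b c <-> [/\ c <= a + b, a <= b + c, b <= a + c & triangle_allowed P a b c].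
Proof.
move=> ha hb hc; rewrite /compat /triangle_allowed; split.
  case/and4P => h1 h2 h3 h; split=> //; split=> ho; rewrite ?ho ?(negPf ho) in h => //; lia.
case=> h1 h2 h3 [ho he]; apply/and4P; split=> //; case: ifP => h.
  by have [] := ho h; move=> *; apply/and5P; split; lia.
by apply: he; rewrite h.
Qed.

Lemma compat_swap P a b c : compat P a b c = compat P b a c.
Proof. rewrite /compat (addnC b a); case: odd; lia. Qed.

Lemma compat_rot P a b c : compat P a b c = compat P b c a.
Proof. rewrite /compat (_ : b + c + a = a + b + c); last lia. by case: odd; lia. Qed.

Lemma compat0 P b c : 2 * b < C0 P -> compat P 0 b c = (b == c).
Proof.
move=> h; apply/idP/eqP => [|<-].
  by case/and4P => h1 h2 h3 _; lia.
rewrite /compat (_ : odd _ = false); last lia. by apply/and4P; split; lia.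
Qed.

(** * The choice of M *)

Definition nice (P : params) (M : nat) : Prop := exists kap tie,
  bounds (zn (delta P)) (zn (K1 P)) (zn (K2 P)) (zn (C0 P)) (zn (C1 P)) (zn M) /\
  (boundsIII (zn (delta P)) (zn (K1 P)) (zn (K2 P)) (zn (C0 P)) (zn (C1 P)) (zn M) kap tie \/
   boundsII (zn (delta P)) (zn (K1 P)) (zn (K2 P)) (zn (C0 P)) (zn (C1 P)) (zn M) kap tie \/
   boundsIIB (zn (delta P)) (zn (K1 P)) (zn (K2 P)) (zn (C0 P)) (zn (C1 P)) (zn M) kap tie).

(** The conditions K1 <= M and delta <= 2M ask for M = max(K1, ceil(delta/2)); only one subcase of
    Case (III) needs a larger value. Excluding K1 = delta and C = 2 delta + 2 gives the strict
    inequalities in [bounds]. *)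
Lemma admissible_nice P : primitive_admissible_params P ->
  (case_III P -> K1 P <> delta P /\ Cmin P <> 2 * delta P + 2) -> exists M, nice P M.
Proof.
case: P => d k1 k2 c0 c1; rewrite /primitive_admissible_params /case_II /case_III /nice /Cmin /Cmax
  /=.
move=> [h1 [h2 [h3 h4]] [h5 h6 h7 h8] [h9 h10] hc] hS.
have h5' : 2 * d < c0 by lia. have h5'' : c0 <= 3 * d + 2 by lia.
have h6' : 2 * d < c1 by lia. have h6'' : c1 <= 3 * d + 2 by lia.
clear h5 h6.
case: hc => [[a1 a2 a3 a4 a5]|cIII].
  pose M := maxn k1 (uphalf d).
  exists M, (zn k1 + 1)%Z.
  have hM : M = k1 \/ k1 <= M /\ M = uphalf d by rewrite /M; lia.
  have hM2 : k1 <= M /\ uphalf d <= M by rewrite /M; lia.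
  clearbody M.
  have hcom : bounds (zn d) (zn k1) (zn k2) (zn c0) (zn c1) (zn M).
    rewrite /bounds. do 10 (split; first lia). exists (zn (c0./2)), (zn (c1./2)); lia.
  case: a5 => [a5|[a5 a6 a7]].
    exists False; split=> //; right; left; rewrite /boundsII; split=> //; do !split; lia.
  have [e|ne] := eqVneq (maxn c0 c1) (minn c0 c1 + 1).
    exists False; split=> //; right; left; rewrite /boundsII; split=> //; do !split; lia.
  exists True; split=> //; right; right; rewrite /boundsIIB; split=> //; do !split; lia.
have {hS} [s1 s2] := hS cIII; case: cIII => a1 a2 a3 a4 a5.
(* In the tight case C = 2*d+k1+1 the perimeter bound can cut a top down to k1, so parity has to
   become irrelevant from k1 on; otherwise k1+1 is a possible threshold. *)
pose kap := if (c0 == 2 * d + k1 + 1) || (c1 == 2 * d + k1 + 1) then k1 else k1 + 1.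
pose M0 := maxn k1 (uphalf d).
(* [boundsIII] asks for 2*d <= M+2*k2. For M = k1 this fails exactly if k1+2*k2 = 2*d-1, and then
   3*k2 >= 2*d forces k1 < k2, so that k1+1 is available. *)
pose M := if (M0 == k1) && (k1 + 2 * k2 == 2 * d - 1) then k1 + 1 else M0.
exists M, (zn kap), False.
have hk : (c0 = 2 * d + k1 + 1 \/ c1 = 2 * d + k1 + 1) /\ kap = k1 \/ (c0 <> 2 * d + k1 + 1 /\
  c1 <> 2 * d + k1 + 1 /\ kap = k1 + 1).
  by rewrite /kap; case: eqP => ? /=; [left; lia|case: eqP => ? /=; [left; lia|right]].
have hM0 : k1 <= M0 /\ uphalf d <= M0 /\ (M0 = k1 \/ M0 = uphalf d) by rewrite /M0; clear; lia.
have hM : (M0 = k1 /\ k1 + 2 * k2 = 2 * d - 1 /\ M = k1 + 1) \/ (M = M0 /\ (M0 <> k1 \/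
  k1 + 2 * k2 <> 2 * d - 1)).
  by rewrite /M; case: eqP => ? /=; [case: eqP => ? /=; [left|right; lia]|right; lia].
clearbody M M0 kap.
have hd : k1 < d by clear -h7 h8 h5'' h6'' a1 s1; lia.
have hMb : [&& k1 <= M, M <= k2, d <= 2 * M, M < d & 2 * M + d < minn c0 c1].
  clear -hM hM0 a1 a2 a3 a4 hd h1 h2 h3 h9; apply/and5P; split; lia.
case/and5P: hMb => m1 m2 m3 m4 m5.
split.
  rewrite /bounds; clear -h1 h2 h3 hd h9 h10 m1 m2 m3 m4 m5 a1 s2 h7 h8.
  do 10 (split; first lia); exists (zn (c0./2)), (zn (c1./2)); clear -h7 h8; lia.
left; rewrite /boundsIII; split=> //.
do 8 (split; first (clear -h1 h2 h3 h8 h9 h10 a1 a2 a3 a4 s1 s2 hk hM hM0 m1; lia)).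
have [e|ne] := leqP (maxn c0 c1) (minn c0 c1 + 1).
  have [e'|e'] := leqP c0 c1; [left|right; left]; clear -e e' h7 h8; lia.
right; right; move: (a5 ltac:(lia)) => {}a5.
have {hM} hM : 2 * d + M < minn c0 c1 by clear -hM hM0 a1 a3 a4 a5 s2 h1 h9 h10 h8; lia.
clear -hM a5; lia.
Qed.

(** * The sum of a sequence of labels *)

Section Nice.
Variables (P : params) (M : nat).
Hypothesis niceP : nice P M.
Notation dl := (delta P).

Lemma nice_C0 : 2 * dl + 4 <= C0 P.
Proof. case: niceP => kap [tie [[_ [_ [_ [h _]]]] _]]; lia. Qed.

Lemma nice_d : 3 <= dl.
Proof. case: niceP => kap [tie [[h _] _]]; lia. Qed.

Lemma nice_M : 2 <= M < dl.
Proof.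
case: niceP => kap [tie [h h']]; have := M_ge2 _ _ _ _ _ _ _ _ h h'.
by case: h => [_ [_ [_ [_ [_ [_ [_ [? _]]]]]]]]; lia.
Qed.

Lemma compat00 b c : b <= dl -> compat P 0 b c = (b == c).
Proof. by move=> h; apply: compat0; have := nice_C0; lia. Qed.

Lemma compat_refl b : b <= dl -> compat P b b 0.
Proof. by move=> h; rewrite -compat_rot compat00. Qed.

Lemma compat_assoc a b c g e : a <= dl -> b <= dl -> c <= dl -> g <= dl -> e <= dl ->
  compat P a b e -> compat P e c g -> exists f, [/\ f <= dl, compat P b c f & compat P a f g].
Proof.
move=> ha hb hc hg he h1 h2.
have [a0|a0] := posnP a.
  move: h1; rewrite a0 compat00 // => /eqP e0; exists g; split=> //; first by rewrite e0.
  by rewrite compat00.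
have [b0|b0] := posnP b.
  move: h1; rewrite b0 compat_swap compat00 // => /eqP e0; exists c; split=> //;
    first by rewrite compat00.
  by rewrite e0.
have [c0|c0] := posnP c.
  move: h2; rewrite c0 compat_swap compat00 // => /eqP e0; exists b; split=> //;
    first by rewrite compat_swap compat00.
  by rewrite -e0.
have [g0|g0] := posnP g.
  move: h2; rewrite g0 -compat_rot compat00 // => /eqP e0; exists a; split=> //;
    last by rewrite compat_refl.
  by rewrite -compat_rot -e0.
case: niceP => kap [tie [h h']].
have [|||||||f [hf [f1 f2]]] := tri_assoc _ _ _ _ _ _ _ _ h h' (zn a) (zn b) (zn c) (zn g) (zn e);
  try lia.
- exact/compatP.
- exact/compatP.
exists (Z.to_nat f); split; first lia; apply/compatP; rewrite Z2Nat.id //; lia.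
Qed.

(* [lsum l c]: an edge labelled [c] may join the ends of a walk with labels [l]. *)
Fixpoint lsum (l : seq nat) (c : nat) : Prop :=
  if l is a :: l' then c <= dl /\ exists2 e, lsum l' e & compat P a e c else c = 0.

Definition labels (l : seq nat) := all (fun a => 0 < a <= dl) l.

Lemma labels_le l : labels l -> all (fun a => a <= dl) l.
Proof. by apply: sub_all => a /andP[]. Qed.

Lemma lsum_le l c : lsum l c -> c <= dl.
Proof. by case: l => [->|a l []]. Qed.

Lemma lsum1 a c : a <= dl -> lsum [:: a] c <-> c = a.
Proof.
move=> ha; split=> [[hc [e /= -> ]]|->]; first by rewrite compat_swap compat00 // => /eqP.
by split=> //; exists 0 => //; rewrite compat_swap compat00.
Qed.

Lemma lsum_cons0 a l : a <= dl -> lsum (a :: l) 0 <-> lsum l a.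
Proof.
move=> ha; split=> [[_ [e he]]|h]; last by split=> //; exists a => //; rewrite compat_refl.
by have hed := lsum_le he; rewrite -compat_rot compat00 // => /eqP ->.
Qed.

Lemma lsum_cat l1 l2 c : all (fun a => a <= dl) l1 -> lsum (l1 ++ l2) c <->
  c <= dl /\ exists e1 e2, [/\ lsum l1 e1, lsum l2 e2 & compat P e1 e2 c].
Proof.
elim: l1 c => [|a l1 IH] c /=.
  move=> _; split=> [h|[hc [e1 [e2 [-> h2]]]]].
    have hc := lsum_le h; split=> //; exists 0, c; split=> //; by rewrite compat00.
  by have h := lsum_le h2; rewrite compat00 // => /eqP<-.
case/andP=> ha hl; split.
  case=> hc [e /(IH _ hl)[he [e1 [e2 [h1 h2 h3]]]] h4]; split=> //.
  have [d1 d2] := (lsum_le h1, lsum_le h2).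
  have [|||||||f [hf f1 f2]] := @compat_assoc e2 e1 a c e => //.
  - by rewrite compat_swap.
  - by rewrite compat_swap.
  exists f, e2; split=> //; last by rewrite compat_swap.
  by split=> //; exists e1 => //; rewrite compat_swap.
case=> hc [f [e2 [[hf [e1 h1 h4]] h2 h5]]].
have [d1 d2] := (lsum_le h1, lsum_le h2).
have [|||||||e [he f1 f2]] := @compat_assoc a e1 e2 c f => //.
split=> //; exists e => //; apply/(IH _ hl); split=> //; by exists e1, e2.
Qed.

Lemma lsum_rot l1 l2 : all (fun a => a <= dl) l1 -> all (fun a => a <= dl) l2 ->
  lsum (l1 ++ l2) 0 -> lsum (l2 ++ l1) 0.
Proof.
move=> h1 h2 /(lsum_cat _ _ h1)[_ [e1 [e2 [s1 s2 c12]]]].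
apply/(lsum_cat _ _ h2); split=> //; exists e2, e1; split=> //; by rewrite compat_swap.
Qed.

(** Two closed walks glued along an edge labelled [e], which then disappears. This is how long
    closed walks are controlled by short ones. *)
Lemma lsum_insert l1 l2 l3 e : all (fun a => a <= dl) l1 -> all (fun a => a <= dl) l2 ->
  lsum l2 e -> lsum (l1 ++ e :: l3) 0 -> lsum (l1 ++ l2 ++ l3) 0.
Proof.
move=> h1 h2 s2 /(lsum_cat _ _ h1)[_ [e1 [f [s1 [hf [g sg cg]] c]]]].
apply/(lsum_cat _ _ h1); split=> //; exists e1, f; split=> //.
by apply/(lsum_cat _ _ h2); split=> //; exists e, g.
Qed.

Definition zset (l : seq nat) (z : Z) : Prop := exists2 n, lsum l n & z = zn n.

Lemma lsum_helly (F : seq nat -> Prop) :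
  (forall l, F l -> labels l /\ l != [::]) ->
  (forall l l', F l -> F l' -> exists2 x, lsum l x & lsum l' x) ->
  exists2 c, 0 < c <= dl & forall l, F l -> lsum l c.
Proof.
case: niceP => kap [tie [h h']] hF hI.
have [|T T' [l [Fl eT]] [l' [Fl' eT']]|c [hc Hc]] :=
  good_helly _ _ _ _ _ _ _ _ h h' (fun T => exists l, F l /\ forall z, T z <-> zset l z).
- move=> T [l [Fl eT]]; have [] := hF l Fl; move=> labl nl.
  suff [m [m1 [m2 [m3 m4]]]] : good (zn dl) (zn (K2 P)) (zn M) kap tie (zset l).
    exists m; split=> //; split; first by apply/eT.
    split=> [x /eT|x c /eT hx hc c1 c2]; first exact: m3.
    by apply/eT; apply: m4 hx hc c1 c2.
  elim: l {T Fl eT} labl nl => // a l IH /=/andP[ha labl] _.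
  have [l0|nl] := eqVneq l [::].
    have [|m [m1 [m2 [m3 m4]]]] := good_single (zn dl) (zn (K2 P)) (zn M) kap tie (zn a); first lia.
    have E z : zset (a :: l) z <-> z = zn a.
      rewrite l0; split=> [[n /lsum1 -> //]|->]; first by case/andP: ha.
      by exists a => //; apply/lsum1 => //; case/andP: ha.
    exists m; split=> //; split; first by apply/E.
    split=> [x /E|x c /E hx hc c1 c2]; first exact: m3.
    by apply/E; apply: m4 hx hc c1 c2.
  have [|m [m1 [m2 [m3 m4]]]] := good_add _ _ _ _ _ _ _ _ h h' (zn a) _ _ (IH labl nl); first lia.
  have E z : zset (a :: l) z <-> (0 <= z <= zn dl)%Z /\ (exists x, zset l x /\
    tri (zn (K1 P)) (zn (K2 P)) (zn (C0 P)) (zn (C1 P)) (zn a) x z).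
    split=> [[n [hn [e se ce]] ->]|[hz [x [[n sn ->] t]]]].
      by split; first lia; exists (zn e); split; [exists e|apply/compatP].
    exists (Z.to_nat z); last lia. split; first lia.
    exists n => //; apply/compatP; rewrite Z2Nat.id //; lia.
  exists m; split=> //; split; first by apply/E. split=> [x /E|x c /E hx hc c1 c2]; first exact: m3.
  by apply/E; apply: m4 hx hc c1 c2.
- have [x h1 h2] := hI l l' Fl Fl'; exists (zn x); split; [apply/eT|apply/eT']; by exists x.
exists (Z.to_nat c); first lia.
move=> l Fl; have [|n hn ->] := Hc (zset l); first by exists l.
by rewrite Nat2Z.id.
Qed.

Lemma compat_MM j : j <= dl -> compat P M M j.
Proof. case: niceP => kap [tie [h h']] hj; apply/compatP; apply: (tri_MM _ _ _ _ _ _ _ _ h h');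
lia. Qed.

(** In a long sequence some label [a] occurs often. Since [a], [a] sum to 0 and to 2, enough copies
    of [a] reach [M], and [M] survives any further label because (M, M, e) is allowed. Two such
    halves give the sum of [M] and [M], which contains every label. *)
Lemma lsum_full : exists n0, forall l, labels l -> n0 <= size l -> forall c, c <= dl -> lsum l c.
Proof.
have [kap [tie [h h']]] := niceP.
have /andP[M2 Md] := nice_M.
have evens a j : 0 < a <= dl -> 2 * j <= dl -> lsum (nseq (2 * j) a) (2 * j).
  move=> ha; elim: j => [|j IH] hj //.
  have {}IH := IH ltac:(lia).
  rewrite (_ : 2 * j.+1 = (2 * j).+2) //; last lia.
  change (nseq (2 * j).+2 a) with ([:: a; a] ++ nseq (2 * j) a).
  apply/lsum_cat; first by rewrite /= !(proj2 (andP ha)).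
  split; first lia. exists 2, (2 * j); split=> //.
    split; first lia. exists a; last by apply/compatP; apply: (tri_aa2 _ _ _ _ _ _ _ _ h h'); lia.
    by apply/lsum1 => //; case/andP: ha.
  apply/compatP. have := tri_2up _ _ _ _ _ _ _ _ h h' (zn (2 * j)) (zn j).
  rewrite (_ : zn (2 * j).+2 = (zn (2 * j) + 2)%Z); last lia. apply; lia.
have zeros a j : 0 < a <= dl -> lsum (nseq (2 * j) a) 0.
  move=> ha; elim: j => [|j IH] //.
  rewrite (_ : 2 * j.+1 = (2 * j).+2) //; last lia.
  change (nseq (2 * j).+2 a) with ([:: a; a] ++ nseq (2 * j) a).
  apply/lsum_cat; first by rewrite /= !(proj2 (andP ha)).
  split=> //; exists 0, 0; split=> //; last by rewrite compat00.
  apply/lsum_cons0; first by case/andP: ha. by apply/lsum1 => //; case/andP: ha.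
have powM a : 0 < a <= dl -> lsum (nseq (2 * M) a) M.
  move=> ha; have hle n : all (fun x => x <= dl) (nseq n a) by rewrite all_nseq; case/andP:
    ha => _ ->; rewrite orbT.
  (* Copies of [a] directly yield only even labels. For odd [M] the values M-1 and M+1 are combined
     through the odd triangle (M-1, M+1, M). *)
  have [Mo|Me] := boolP (odd M).
    pose j := M./2.
    rewrite (_ : 2 * M = 2 * j + 2 * j.+1); last by rewrite /j; lia.
    rewrite nseqD; apply/lsum_cat => //; split; first lia.
    exists (2 * j), (2 * j.+1); split; try apply: evens => //; try (rewrite /j; lia).
    apply/compatP; have := tri_M_around _ _ _ _ _ _ _ _ h h' (zn j).
    rewrite (_ : zn (2 * j) = (zn M - 1)%Z); last by rewrite /j; lia.
    rewrite (_ : zn (2 * j.+1) = (zn M + 1)%Z); last by rewrite /j; lia.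
    by apply; rewrite /j; lia.
  pose j := M./2.
  rewrite (_ : 2 * M = 2 * j + 2 * j); last by rewrite /j; lia.
  rewrite nseqD; apply/lsum_cat => //; split; first lia.
  exists M, 0; split=> //; last by rewrite compat_rot compat00 // ltnW.
    have e : 2 * j = M by rewrite /j; lia.
    by rewrite -[X in lsum _ X]e; apply: evens => //; lia.
  exact: zeros.
(* Commutativity: all occurrences of [a] may be collected in front. *)
have sepl (a : nat) l c : labels l -> lsum (filter (pred1 a) l ++ filter (predC1 a) l) c ->
  lsum l c.
  elim: l c => [|x l IH] c //= /andP[/andP[x0 hx] hl].
  have := labels_le hl => hl'.
  have hf (q : pred nat) : all (fun x => x <= dl) (filter q l) by apply/allP => y;
    rewrite mem_filter => /andP[_ /(allP hl')].
  case: eqP => [_|_] /=; first by case=> hc [e /(IH _ hl) h1 h2]; split=> //; exists e.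
  case/(lsum_cat _ _ (hf _)) => hc [e1 [f [h1 [hf1 [g h2 h3]] h4]]].
  have [d1 d2] := (lsum_le h1, lsum_le h2).
  have [|||||||u [hu u1 u2]] := @compat_assoc x g e1 c f => //; first by rewrite compat_swap.
  split=> //; exists u => //; apply: (IH _ hl); apply/(lsum_cat _ _ (hf _)); split=> //.
  by exists e1, g; split=> //; rewrite compat_swap.
have count_nseq a l : filter (pred1 a) l = nseq (count_mem a l) a.
  by elim: l => //= x l ->; case: eqP => [->|].
have gotM l : labels l -> dl.+1 * (2 * M) < size l -> lsum l M.
  move=> hl hs.
  have [|a ha] := @pigeonhole nat 'I_dl.+1 (fun x => inord x) l (2 * M); first by rewrite card_ord.
  have {}ha : 2 * M < count_mem (a : nat) l.
    apply: leq_trans ha _; rewrite leq_eqVlt; apply/orP; left; apply/eqP; apply: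
      eq_in_count => x xl /=.
    have /andP[_ xd] := allP hl x xl.
    by apply/eqP/eqP => [<-|->]; [rewrite inordK | apply/val_inj; rewrite /= inordK].
  have a0 : 0 < a <= dl by apply: (allP hl); rewrite -has_pred1 has_count; apply: leq_ltn_trans ha.
  apply: (sepl a) => //; rewrite count_nseq.
  rewrite -(subnKC (ltnW ha)) nseqD -catA.
  apply/lsum_cat; first by rewrite all_nseq; case/andP: a0 => _ ->; rewrite orbT.
  split; first lia.
  have hr : labels (nseq (count_mem (a : nat) l - 2 * M) (a : nat) ++ [seq x <- l | predC1 (a :
    nat) x]).
    rewrite /labels all_cat all_nseq a0 orbT /=; apply/allP => y;
      rewrite mem_filter => /andP[_ /(allP hl)] //.
  move: hr; set r := _ ++ _ => hr.
  have [e se] : exists e, lsum r e.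
    elim: r hr => [|x r IH] /=; first by exists 0.
    case/andP=> /andP[x0 hx] /IH[e se]; have ed := lsum_le se.
    have [e0|e0] := posnP e.
      by exists x; split=> //; exists e => //; rewrite e0 compat_swap compat00.
    have [||t ht] := top_exists _ _ _ _ _ _ _ _ h h' (zn x) (zn e); [lia|lia|].
    have [|||ht1 ht2] := top_tri _ _ _ _ _ _ _ _ h h' (zn x) (zn e) t; [lia|lia|by []|].
    exists (Z.to_nat t); split; first lia. exists e => //; apply/compatP; rewrite Z2Nat.id //; lia.
  exists M, e; split=> //; first exact: powM.
  by rewrite -compat_rot; apply: compat_MM; apply: lsum_le se.
exists (2 * (dl.+1 * (2 * M)).+1) => l hl hs c hc.
rewrite -(cat_take_drop (dl.+1 * (2 * M)).+1 l).
have [hl1 hl2] : labels (take (dl.+1 * (2 * M)).+1 l) /\ labels (drop (dl.+1 * (2 * M)).+1 l).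
  by move: hl; rewrite -{1}(cat_take_drop (dl.+1 * (2 * M)).+1 l) /labels all_cat => /andP.
apply/lsum_cat; first exact: labels_le.
split=> //; exists M, M; split; last exact: compat_MM.
  by apply: gotM => //; rewrite size_takel; lia.
by apply: gotM => //; rewrite size_drop; lia.
Qed.
End Nice.

(** * The partite construction *)

Record picture (V : finType) := Picture {
  pvert :> finType;
  plab : pvert -> pvert -> option nat;
  pproj : pvert -> V }.

Definition pict_wf (V : finType) (D : nat) (Q : picture V) : Prop :=
  [/\ forall x y : Q, plab x y = plab y x,
      forall (x y : Q) d, plab x y = Some d -> 0 < d <= D
    & forall (x y : Q) d, plab x y = Some d -> pproj x != pproj y].

Section Step.
Variables (V : finType) (D : nat) (Q : picture V) (A : finspace) (al : A -> V) (I : finType).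
Hypotheses (wfQ : pict_wf D Q) (al_inj : injective al).
Hypothesis (A_le : forall x y : A, x <> y -> 0 < fdist x y <= D).

Definition transversal_copy (g : {ffun A -> Q}) : bool :=
  [forall a, pproj (g a) == al a] &&
  [forall a, forall b, (a != b) ==> (plab (g a) (g b) == Some (fdist a b))].
Definition letter : finType := {g : {ffun A -> Q} | transversal_copy g}.
Notation word := {ffun I -> option letter}.
(* The power of [Q] over [A], glued to one copy of [Q] for each word [w]; the copy of
   [w] meets the power in the vertices lying over the image of [al]. *)
Definition amalgam : finType := ((A * {ffun I -> Q}) + (word * Q))%type.

(** The vertices of the power proper. The remaining pairs stay as vertices without edges, so that
    the vertex type is a plain product. *)
Definition homog (u : A * {ffun I -> Q}) : bool := [forall c, pproj (u.2 c) == al u.1].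

(* Only the variable coordinates of a line can show anything but the distance in [A],
   so they take precedence; hence each copy of [Q] keeps its labels and its nonedges. *)
Definition power_lab (u v : A * {ffun I -> Q}) : option nat :=
  if [&& u.1 != v.1, homog u & homog v] then
    if [pick c | plab (u.2 c) (v.2 c) != Some (fdist u.1 v.1)] is Some c
    then plab (u.2 c) (v.2 c) else Some (fdist u.1 v.1)
  else None.

Definition cp (w : word) (x : Q) : amalgam :=
  if [pick a | al a == pproj x] is Some a
  then inl (a, [ffun c => if w c is Some g then sval g a else x]) else inr (w, x).

(** A word without a variable coordinate need not give an injective copy, so [copy_lab] takes labels
    from lines only. *)
Definition isline (w : word) : bool := [exists c, w c == None].

Definition copy_lab (u v : amalgam) : option nat :=
  if [pick t : word * Q * Q | [&& isline t.1.1, cp t.1.1 t.1.2 == u & cp t.1.1 t.2 == v]] is Some t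
  then plab t.1.2 t.2 else None.

Definition amalgam_lab (u v : amalgam) : option nat :=
  if u is inl u' then if v is inl v' then power_lab u' v' else copy_lab u v else copy_lab u v.

Definition amalgam_proj (u : amalgam) : V := match u with inl u => al u.1 | inr u => pproj u.2 end.

Definition step_picture : picture V := @Picture V amalgam amalgam_lab amalgam_proj.

Lemma letterP (g : letter) : (forall a, pproj (sval g a) = al a) /\
  (forall a b, a != b -> plab (sval g a) (sval g b) = Some (fdist a b)).
Proof.
have /andP[/forallP h1 /forallP h2] := svalP g; split=> [a|a b ab]; first exact/eqP.
by have /forallP/(_ b) := h2 a; rewrite ab => /eqP.
Qed.

Lemma cp_al w x a : al a = pproj x ->
  cp w x = inl (a, [ffun c => if w c is Some g then sval g a else x]).
Proof.
move=> e; rewrite /cp; case: pickP => [b /eqP|/(_ a)]; last by rewrite e eqxx.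
by rewrite -e => /al_inj->.
Qed.

Variant cp_spec (w : word) (x : Q) : amalgam -> Prop :=
| CpIn a of al a = pproj x : cp_spec w x (inl (a, [ffun c => if w c is Some g then sval g a else
  x]))
| CpOut of (forall a, al a != pproj x) : cp_spec w x (inr (w, x)).

Lemma cpP w x : cp_spec w x (cp w x).
Proof.
rewrite /cp; case: pickP => [a /eqP|h]; first exact: CpIn.
by apply: CpOut => a; rewrite h.
Qed.

Lemma cp_proj w x : amalgam_proj (cp w x) = pproj x.
Proof. by case: cpP. Qed.

Lemma cp_inj w : isline w -> injective (cp w).
Proof.
case/existsP=> c /eqP wc x y.
case: cpP => [a ea|na]; case: cpP => [b eb|nb] // [] //.
by move=> _ /ffunP/(_ c); rewrite !ffunE wc.
Qed.

Lemma cp_homog w x a phi : cp w x = inl (a, phi) -> homog (a, phi) /\ pproj x = al a.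
Proof.
case: cpP => // b eb [<- <-]; split=> //; apply/forallP => c; rewrite /= ffunE.
by case: (w c) => [g|]; [rewrite (letterP g).1|rewrite eb].
Qed.

Lemma power_lab_sym u v : power_lab u v = power_lab v u.
Proof.
have [sy _ _] := wfQ; have [_ dS _] := fdistP A.
rewrite /power_lab eq_sym (andbC (homog u)); case: ifP => // _; rewrite dS.
by under eq_pick => c do rewrite sy; case: pickP => // c _; rewrite sy.
Qed.

Lemma power_labP u v d : power_lab u v = Some d ->
  [/\ u.1 != v.1, homog u, homog v & d = fdist u.1 v.1 \/ exists c, plab (u.2 c) (v.2 c) = Some d].
Proof.
rewrite /power_lab; case: ifP => // /and3P[h1 h2 h3].
by case: pickP => [c _ e|_ [<-]]; split=> //; [right; exists c|left].
Qed.

Lemma cp_inr (w w' : word) x y : cp w x = inr (w', y) -> w = w' /\ x = y.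
Proof. by case: cpP => // _ [-> ->]. Qed.

(** A vertex outside the power determines its word, and [cp w] is injective for a line; hence the
    choice made by [pick] does not matter. *)
Lemma copy_lab_cp w x y : isline w -> (forall u v, cp w x = inl u -> cp w y = inl v -> False) ->
  copy_lab (cp w x) (cp w y) = plab x y.
Proof.
move=> lw nn; rewrite /copy_lab; case: pickP => [[[w1 x1] y1] /and3P[/= l1 /eqP e1 /eqP e2]|/(_ (w,
  x, y))]; last by rewrite /= lw !eqxx.
have ww : w1 = w.
  case Ex: (cp w x) => [u|[w' x']].
    case Ey: (cp w y) => [v|[w' y']]; first by case: (nn u v).
    by have [-> _] := cp_inr Ey; move: e2; rewrite Ey => /cp_inr[].
  by have [-> _] := cp_inr Ex; move: e1; rewrite Ex => /cp_inr[].
by rewrite ww in e1 e2; rewrite (cp_inj lw e1) (cp_inj lw e2).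
Qed.

Lemma copy_labP u v d : copy_lab u v = Some d ->
  exists w x y, [/\ isline w, u = cp w x, v = cp w y & plab x y = Some d].
Proof.
by rewrite /copy_lab; case: pickP => // -[[w x] y] /and3P[/= lw /eqP<- /eqP<-] e; exists w, x, y.
Qed.

Lemma copy_lab_sym u v : (forall u' v', u = inl u' -> v = inl v' -> False) ->
  copy_lab u v = copy_lab v u.
Proof.
have [sy _ _] := wfQ => nn.
have H w x y : isline w -> u = cp w x -> v = cp w y -> copy_lab u v = copy_lab v u.
  move=> lw eu ev; rewrite eu ev !copy_lab_cp // => [u' v' e1 e2|u' v' e1 e2].
    by apply: (nn v' u'); rewrite ?eu ?ev.
  by apply: (nn u' v'); rewrite ?eu ?ev.
case E1: (copy_lab u v) => [d|]; last case E2: (copy_lab v u) => [d|//].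
  by have [w [x [y [lw eu ev _]]]] := copy_labP E1; rewrite -E1; apply: H eu ev.
by have [w [x [y [lw eu ev _]]]] := copy_labP E2; rewrite -E1 -E2; apply: H ev eu.
Qed.

Lemma amalgam_lab_sym u v : amalgam_lab u v = amalgam_lab v u.
Proof.
by case: u => [u|u]; case: v => [v|v] /=; rewrite ?(power_lab_sym u v) // /amalgam_lab copy_lab_sym.
Qed.

Lemma amalgam_lab_cp w x y : isline w -> amalgam_lab (cp w x) (cp w y) = plab x y.
Proof.
move=> lw; have [_ _ pa] := wfQ.
rewrite /amalgam_lab; case Ex: (cp w x) => [[a phi]|x']; last by rewrite -Ex copy_lab_cp // => u v;
  rewrite Ex.
case Ey: (cp w y) => [[b psi]|y']; last by rewrite -Ex -Ey copy_lab_cp // => u v _; rewrite Ey.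
have [ha pxa] := cp_homog Ex; have [hb pyb] := cp_homog Ey.
rewrite /power_lab ha hb /= andbT.
have [ab|ab] /= := eqVneq a b.
  by case E: (plab x y) => [d|//]; have := pa _ _ _ E; rewrite pxa pyb ab eqxx.
have ephi : phi = [ffun c => if w c is Some g then sval g a else x].
  by move: Ex; rewrite (cp_al w (esym pxa)) => -[].
have epsi : psi = [ffun c => if w c is Some g then sval g b else y].
  by move: Ey; rewrite (cp_al w (esym pyb)) => -[].
case: pickP => [c|no].
  by rewrite ephi epsi !ffunE; case: (w c) => // g; rewrite (letterP g).2 // eqxx.
have /existsP[c /eqP wc] := lw.
by have := no c; rewrite ephi epsi !ffunE wc => /negbFE/eqP.
Qed.

Lemma step_wf : pict_wf D step_picture.
Proof.
have [sy rg pa] := wfQ.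
split=> /= [|[u|u] [v|v] d|[u|u] [v|v] d] /=; first exact: amalgam_lab_sym.
- by case/power_labP => uv _ _ [->|[c /rg]] //; apply: A_le; apply/eqP.
- by case/copy_labP => w [x [y [_ _ _ /rg]]].
- by case/copy_labP => w [x [y [_ _ _ /rg]]].
- by case/copy_labP => w [x [y [_ _ _ /rg]]].
- by case/power_labP => uv _ _ _; rewrite (inj_eq al_inj).
- by case/copy_labP => w [x [y [_ eu ev /pa]]]; rewrite -(cp_proj w x) -(cp_proj w y) -eu -ev.
- by case/copy_labP => w [x [y [_ eu ev /pa]]]; rewrite -(cp_proj w x) -(cp_proj w y) -eu -ev.
- by case/copy_labP => w [x [y [_ eu ev /pa]]]; rewrite -(cp_proj w x) -(cp_proj w y) -eu -ev.
Qed.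

Lemma amalgam_lab_inr w z v d : amalgam_lab (inr (w, z)) v = Some d ->
  isline w /\ exists x y, inr (w, z) = cp w x /\ v = cp w y.
Proof.
case/copy_labP=> w' [x [y [lw eu ev _]]]; have [ew _] := cp_inr (esym eu); rewrite ew in lw eu ev.
by split=> //; exists x, y.
Qed.

Definition transversal (f : {ffun I -> letter}) : {ffun A -> amalgam} :=
  [ffun a => inl (a, [ffun c => sval (f c) a])].

(** The link with combinatorial lines: as [g] runs through the copies of [A] over [al] in [Q], its
    images in the copy of [w] run through the points of the line [w]. *)
Lemma cp_transversal w (g : letter) : [ffun a => cp w (sval g a)] = transversal (line_at w g).
Proof.
apply/ffunP => a; rewrite !ffunE (cp_al w (esym ((letterP g).1 a))); congr (inl (_, _)).
by apply/ffunP => c; rewrite !ffunE; case: (w c).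
Qed.
End Step.

Lemma step_mono (V : finType) (Q : picture V) (A : finspace) (al : A -> V) (al_inj :
  injective al) (K : finType) :
  exists I : finType, forall chi : {ffun A -> amalgam Q al I} -> K,
  exists2 w, isline w & forall g1 g2, transversal_copy al g1 -> transversal_copy al g2 ->
    chi [ffun a => cp w (g1 a)] = chi [ffun a => cp w (g2 a)].
Proof.
have [I HI] := Hales_Jewett (enum (letter Q al)) K.
exists I => chi; have [w [i wi] Hw] := HI (fun f => chi (transversal f)).
exists w; first by apply/existsP; exists i; rewrite wi.
move=> g1 g2 h1 h2.
have := Hw (Sub g1 h1) (Sub g2 h2); rewrite !mem_enum => /(_ isT isT).
by rewrite -!cp_transversal // !SubK.
Qed.

(** One amalgamation for each [al] in the list. A colouring is handled from the outside in: the last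
    step provides a copy of the previous picture in which all copies of [A] over its [al] have one
    colour, and induction applies to the colouring induced there. The predicate [Inv] lets the same
    construction serve the base and all later stages. *)
Lemma partite_construction (V : finType) (D : nat) (A : finspace) (K : finType) (Inv : picture V ->
  Prop)
  (als : seq {ffun A -> V}) (Q0 : picture V) :
  (forall x y : A, x <> y -> 0 < fdist x y <= D) ->
  (forall al, al \in als -> injective al) ->
  (forall (Q : picture V) al (I : finType), al \in als -> pict_wf D Q -> Inv Q ->
    Inv (step_picture Q al I)) ->
  pict_wf D Q0 -> Inv Q0 ->
  exists Q : picture V, [/\ pict_wf D Q, Inv Q & forall chi : {ffun A -> Q} -> K,
    exists j : Q0 -> Q, [/\ forall x y, plab (j x) (j y) = plab x y, forall x,
      pproj (j x) = pproj x &
      forall al g1 g2, al \in als -> transversal_copy al g1 -> transversal_copy al g2 ->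
        chi [ffun a => j (g1 a)] = chi [ffun a => j (g2 a)]]].
Proof.
move=> A_le; elim: als => [|al als IH] als_inj HInv wf0 Inv0.
  by exists Q0; split=> // chi; exists id; split.
have [||//|//|Q [wfQ InvQ HQ]] := IH; first by move=> al' h; apply: als_inj; rewrite inE h orbT.
  by move=> Q al' I h; apply: HInv; rewrite inE h orbT.
have al_inj := als_inj al (mem_head _ _).
have [I HI] := @step_mono V Q A al al_inj K.
exists (step_picture Q al I); split; first exact: step_wf.
  by apply: HInv; rewrite ?mem_head.
move=> chi; have [w lw Hw] := HI chi.
have [j [j1 j2 j3]] := HQ (fun g => chi [ffun a => cp w (g a)]).
exists (fun x => cp w (j x)); split=> [x y|x|al' g1 g2].
- by rewrite /= (amalgam_lab_cp wfQ al_inj) // j1.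
- by rewrite /= cp_proj j2.
have tr al0 (g : {ffun A -> Q0}) : transversal_copy al0 g -> transversal_copy al0 [ffun a => j (g
  a)].
  case/andP=> /forallP h1 /forallP h2; apply/andP; split; apply/forallP => a;
    first by rewrite ffunE j2.
  apply/forallP => b; rewrite !ffunE j1; exact: (forallP (h2 a)).
have E (g : {ffun A -> Q0}) : [ffun a => cp w (j (g a))] = [ffun a => cp w ([ffun a => j (g a)] a)].
  by apply/ffunP => a; rewrite !ffunE.
rewrite inE !E => /orP[/eqP->|al'P] t1 t2; first by apply: Hw; apply: tr.
exact: j3 al'P t1 t2.
Qed.

(** * The initial picture and the partite construction for ordered spaces *)

Section InitialPicture.
Variables (V : finType) (D : nat) (B : finspace) (valid : pred {ffun B -> V}).
Hypothesis B_le : forall x y : B, x <> y -> 0 < fdist x y <= D.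
Hypothesis valid_inj : forall be, valid be -> injective be.

(** A disjoint copy of [B] over each valid map; the other maps contribute isolated vertices. *)
Definition copies_lab (u v : {ffun B -> V} * B) : option nat :=
  if [&& u.1 == v.1, valid u.1 & u.2 != v.2] then Some (fdist u.2 v.2) else None.
Definition copies : picture V := @Picture V ({ffun B -> V} * B)%type copies_lab (fun u => u.1 u.2).

Lemma copies_labP u v d : copies_lab u v = Some d -> [/\ u.1 = v.1, valid u.1,
  u.2 != v.2 & d = fdist u.2 v.2].
Proof. by rewrite /copies_lab; case: ifP => // /and3P[/eqP h1 h2 h3] [<-]. Qed.

Lemma copies_wf : pict_wf D copies.
Proof.
have [_ dS _] := fdistP B.
split=> /= [u v|u v d /copies_labP[_ _ /eqP ne ->]|u v d /copies_labP[e va ne _]].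
- rewrite /copies_lab eq_sym (eq_sym u.2) dS; case: eqP => //= ->; by [].
- exact: B_le.
- by rewrite -e (inj_eq (valid_inj va)).
Qed.
End InitialPicture.

Lemma ordered_partite (V : finType) (D : nat) (A B : ordspace) (K : finType) (Inv : picture V ->
  Prop)
  (validB : pred {ffun B -> V}) (validA : pred {ffun A -> V}) :
  (forall x y : A, x <> y -> 0 < fdist x y <= D) ->
  (forall x y : B, x <> y -> 0 < fdist x y <= D) ->
  (forall be, validB be -> injective be) -> (forall al, validA al -> injective al) ->
  (forall be (e : A -> B), validB be -> oembedding e -> validA [ffun a => be (e a)]) ->
  (forall (Q : picture V) al (I : finType), validA al -> pict_wf D Q -> Inv Q ->
    Inv (step_picture Q al I)) ->
  Inv (copies validB) ->
  (forall chi : {ffun A -> V} -> option K, exists2 be, validB be & forall e1 e2 : A -> B,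
    oembedding e1 -> oembedding e2 ->
     chi [ffun a => be (e1 a)] = chi [ffun a => be (e2 a)]) ->
  exists Q : picture V, [/\ pict_wf D Q, Inv Q & forall chi : {ffun A -> Q} -> K, exists f :
    {ffun B -> Q},
     [/\ forall x y, x != y -> plab (f x) (f y) = Some (fdist x y), validB [ffun x => pproj (f x)] &
      forall e1 e2 : A -> B, oembedding e1 -> oembedding e2 ->
        chi [ffun a => f (e1 a)] = chi [ffun a => f (e2 a)]]].
Proof.
move=> A_le B_le B_inj A_inj compAB HInv Inv0 Hbase.
have [|||//|Q [wfQ InvQ HQ]] := @partite_construction V D A K Inv (enum validA) (copies validB)
  A_le.
- by move=> al; rewrite mem_enum; apply: A_inj.
- by move=> Q al I; rewrite mem_enum; apply: HInv.
- exact: copies_wf.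
exists Q; split=> // chi.
have [j [j1 j2 j3]] := HQ chi.
(* After the construction the colour of a copy inside [j] depends only on its projection, hence
   defines a colouring over [V]; [None] is for maps over which the initial picture has no copy. *)
pose chi0 (al : {ffun A -> V}) : option K :=
  omap (fun g : {ffun A -> copies validB} => chi [ffun a => j (g a)]) [pick g |
    transversal_copy al g].
have [be vbe Hbe] := Hbase chi0.
have tc (e : A -> B) : oembedding e -> transversal_copy [ffun a => be (e a)] [ffun a => (be, e a) :
  copies validB].
  move=> [iso _]; apply/andP; split; apply/forallP => a; first by rewrite !ffunE.
  apply/forallP => b; apply/implyP => ab; rewrite !ffunE /= /copies_lab /= eqxx vbe /=.
  have -> : e a != e b.
    apply: contra_neq ab => eab; have [dA _ _] := fdistP A; have [dB _ _] := fdistP B.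
    by apply/dA; rewrite -iso; apply/dB.
  by rewrite iso.
have chi0E (e : A -> B) : oembedding e -> chi0 [ffun a => be (e a)] = Some (chi [ffun a => j (be,
  e a)]).
  move=> oe; rewrite /chi0; case: pickP => [g tg|no]; last by have := tc e oe; rewrite no.
  congr Some; have -> : [ffun a => j (be, e a)] = [ffun a => j ([ffun a => (be, e a) :
    copies validB] a)] by apply/ffunP => a; rewrite !ffunE.
  apply: j3 tg (tc e oe); rewrite mem_enum; exact: compAB.
exists [ffun x => j (be, x)]; split=> [x y xy||e1 e2 o1 o2].
- by rewrite !ffunE j1 /= /copies_lab /= eqxx vbe xy.
- by rewrite (_ : [ffun x => _] = be) //; apply/ffunP => x; rewrite !ffunE j2.
have E (e : A -> B) : [ffun a => [ffun x => j (be, x)] (e a)] = [ffun a => j (be,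
  e a)] by apply/ffunP => a; rewrite !ffunE.
by rewrite !E; apply: Some_inj; rewrite -!chi0E //; apply: Hbe.
Qed.

(** * Consistent edge labellings *)

Definition adj (T : Type) (lab : T -> T -> option nat) : rel T := fun x y => isSome (lab x y).
Definition labs (T : Type) (lab : T -> T -> option nat) (x : T) (p : seq T) : seq nat :=
  pairmap (fun x y => odflt 0 (lab x y)) x p.
Definition consistent (P : params) (n : nat) (T : Type) (lab : T -> T -> option nat) : Prop :=
  forall x p, path (adj lab) x p -> last x p = x -> size p <= n -> lsum P (labs lab x p) 0.

Lemma labs_cat T lab (x : T) p q : labs lab x (p ++ q) = labs lab x p ++ labs lab (last x p) q.
Proof. exact: pairmap_cat. Qed.

Lemma labs_labels P T lab (x : T) p : (forall u v d, lab u v = Some d -> 0 < d <= delta P) ->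
  path (adj lab) x p -> labels P (labs lab x p).
Proof.
move=> rg; elim: p x => //= y p IH x /andP[]; rewrite /adj; case E: (lab x y) => [d|] //= _ /IH h.
by rewrite (rg _ _ _ E).
Qed.

Lemma walk_map T U (lab : T -> T -> option nat) (lab' : U -> U -> option nat) (h : T -> U) x p :
  (forall u v d, lab u v = Some d -> lab' (h u) (h v) = Some d) -> path (adj lab) x p ->
  path (adj lab') (h x) (map h p) /\ labs lab' (h x) (map h p) = labs lab x p.
Proof.
move=> H; elim: p x => //= y p IH x /andP[]; rewrite /adj; case E:
  (lab x y) => [d|] //= _ /IH[h1 h2].
by rewrite (H _ _ _ E) /= h2.
Qed.

Lemma metric_compat P M (X : finspace) : nice P M -> class_A P X ->
  forall x y z : X, compat P (fdist x y) (fdist y z) (fdist x z).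
Proof.
move=> nP [rg nf] x y z; have [d0 dS dT] := fdistP X.
have le (u v : X) : fdist u v <= delta P.
  by have [->|/eqP /rg/andP[]//] := eqVneq u v; rewrite (proj2 (d0 v v)).
have d00 (u : X) : fdist u u = 0 by apply/d0.
have [->|/eqP xy] := eqVneq x y; first by rewrite d00 (compat00 nP).
have [->|/eqP yz] := eqVneq y z; first by rewrite d00 compat_swap (compat00 nP).
have [<-|/eqP xz] := eqVneq x z; first by rewrite d00 -compat_rot (compat00 nP) // dS.
have [/rg/andP[a _] /rg/andP[b _] /rg/andP[c _]] := And3 xy yz xz.
apply/compat_allowed => //; split; [exact: dT | | | exact: nf].
- by rewrite addnC (dS y z); apply: dT.
- by rewrite (dS x y); apply: dT.
Qed.

Lemma walk_metric P M (X : finspace) (T : Type) (lab : T -> T -> option nat) (f : T -> X) x p :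
  nice P M -> class_A P X -> (forall u v d, lab u v = Some d -> d = fdist (f u) (f v)) ->
  path (adj lab) x p -> lsum P (labs lab x p) (fdist (f x) (f (last x p))).
Proof.
move=> nP AX Hf; have [d0 dS dT] := fdistP X.
elim: p x => [|y p IH] x /=; first by rewrite (proj2 (d0 _ _)).
rewrite /adj => /andP[]; case E: (lab x y) => [d|] //= _ /IH h; split.
  have [->|/eqP ne] := eqVneq (f x) (f (last y p)); first by rewrite (proj2 (d0 _ _)).
  by have [/(_ _ _ ne)/andP[]] := AX.
exists (fdist (f y) (f (last y p))) => //; rewrite (Hf _ _ _ E).
exact: metric_compat nP AX _ _ _.
Qed.

(** * Consistency passes to the amalgam *)

Section StepInvariants.
Variables (P : params) (M k : nat) (V : finType) (labV : V -> V -> option nat) (A : finspace) (al :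
  A -> V).
Variables (I : finType) (Q : picture V).
Hypotheses (nP : nice P M) (AA : class_A P A) (al_inj : injective al).
Hypothesis al_iso : forall a b, a != b -> labV (al a) (al b) = Some (fdist a b).
Hypothesis wfQ : pict_wf (delta P) Q.
Hypothesis projQ : forall (x y : Q) d, plab x y = Some d -> labV (pproj x) (pproj y) = Some d.
Notation Q' := (step_picture Q al I).

Lemma power_lab_dist (u v : A * {ffun I -> Q}) d : power_lab al u v = Some d -> u.1 != v.1 /\
  d = fdist u.1 v.1.
Proof.
case/power_labP => uv /forallP hu /forallP hv [->|[c /projQ]] //.
by rewrite (eqP (hu c)) (eqP (hv c)) al_iso // => -[<-].
Qed.

Lemma step_proj (x y : Q') d : plab x y = Some d -> labV (pproj x) (pproj y) = Some d.
Proof.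
case: x y => [u|u] [v|v] /=.
- by move/power_lab_dist => [uv ->]; apply: al_iso.
- by move/copy_labP => [w [x [y [_ eu ev /projQ]]]]; rewrite -(cp_proj w x) -(cp_proj w y) -eu -ev.
- by move/copy_labP => [w [x [y [_ eu ev /projQ]]]]; rewrite -(cp_proj w x) -(cp_proj w y) -eu -ev.
- by move/copy_labP => [w [x [y [_ eu ev /projQ]]]]; rewrite -(cp_proj w x) -(cp_proj w y) -eu -ev.
Qed.

Hypothesis consV : consistent P k labV.
Hypothesis consQ : consistent P k.+1 (@plab V Q).
Hypothesis symV : forall u v, labV u v = labV v u.

Lemma step_consistent : consistent P k.+1 (@plab V Q').
Proof.
have wfQ' : pict_wf (delta P) Q' by apply: step_wf => //; exact: (proj1 AA).
have [sy rg pa] := wfQ'.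
have [d0 dS _] := fdistP A.
pose isl (u : Q') := if u is inl _ then true else false.
pose pr (u : Q') := if u is inl u then Some u.1 else None.
(* A walk inside the power part is a walk in [A]. *)
have Hin x p : path (adj (@plab V Q')) x p -> last x p = x -> all isl (x :: p) ->
  lsum P (labs (@plab V Q') x p) 0.
  case: x => [[a phi]|//] px lx ax.
  pose f (u : Q') := if u is inl u then u.1 else a.
  suff h : lsum P (labs (@plab V Q') (inl (a, phi) : Q') p) (fdist (f (inl (a,
    phi))) (f (last (inl (a, phi) : Q') p))).
    by move: h; rewrite lx (proj2 (d0 _ _)).
  pose lab' (u v : Q') := if isl u && isl v then amalgam_lab u v else None.
  have Hp : forall y q, all isl (y :: q) -> path (adj (@plab V Q')) y q -> path (adj lab') y q /\
    labs lab' y q = labs (@plab V Q') y q.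
    move=> y q; elim: q y => //= z q IH y /and3P[iy iz iq] /andP[yz zq].
    have [|h1 h2] := IH z _ zq; first by rewrite /= iz.
    by rewrite h1 h2 /adj /lab' iy iz /= andbT.
  have [h1 <-] := Hp _ _ ax px.
  apply: (walk_metric nP AA) h1 => -[u|u] [v|v] d //=.
  by rewrite /lab' /= => /power_lab_dist[].
(* A walk based outside the power part leaves and re-enters its copy of [Q] through
   two vertices lying over [al]; the edge of [al] between them cuts the walk into two
   closed walks of [V], both of length at most [k]. *)
have Hout w z p : path (adj (@plab V Q')) (inr (w, z)) p -> last (inr (w, z)) p = inr (w, z) ->
  size p <= k.+1 ->
    lsum P (labs (@plab V Q') (inr (w, z) : Q') p) 0.
  set x0 : Q' := inr (w, z) => px lx sp.
  have [p0|pn0] := eqVneq p [::]; first by rewrite p0.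
  have [lw [z0 ez0]] : isline w /\ exists z0, x0 = cp w z0.
    case: p px pn0 {lx sp} => //= y p /andP[]; rewrite /adj /=; case E:
      (copy_lab _ _) => [d|] // _ _ _.
    by have [lw [x [y' [ex _]]]] := amalgam_lab_inr (v := y) E; split=> //; exists x.
  pose R (u : Q') := [exists x, cp w x == u].
  have RP u : reflect (exists x, u = cp w x) (R u).
    by apply: (iffP existsP) => -[x]; [move/eqP<-|move->]; exists x.
  have Rx0 : R x0 by apply/RP; exists z0.
  (* A vertex outside the power has neighbours only in its own copy, so a walk can leave the copy of
     [w] only from a vertex of the power. *)
  have exitl (u v : Q') : adj (@plab V Q') u v -> R u -> ~~ R v -> isl u.
    case: u => [//|[w1 z1]].
    rewrite /adj /=; case E: (copy_lab _ _) => [d|] // _ /RP[x ex] /RP[].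
    have [_ [x1 [y1 [e1 e2]]]] := amalgam_lab_inr (v := v) E.
    by have [ew _] := cp_inr (esym ex); exists y1; rewrite ew.
  have [allR|nallR] := boolP (all R p).
    pose f (u : Q') := odflt z0 [pick x | cp w x == u].
    have fK u : R u -> cp w (f u) = u.
      by move=> /RP[x ex]; rewrite /f; case: pickP => [y /eqP //|/(_ x)]; rewrite ex eqxx.
    have pK : map (cp w) (map f p) = p.
      by rewrite -map_comp -[RHS]map_id; apply/eq_in_map => u up /=; apply: fK; apply: (allP allR).
    have labK u v d : plab u v = Some d -> plab (cp w u : Q') (cp w v :
      Q') = Some d by rewrite /= (amalgam_lab_cp wfQ al_inj).
    have pf : path (adj (@plab V Q)) z0 (map f p).
      move: px; rewrite ez0 -{1}pK path_map; apply: sub_path => u v.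
      by rewrite /adj /= (amalgam_lab_cp wfQ al_inj).
    have [_] := walk_map labK pf; rewrite pK -ez0 => ->.
    apply: consQ => //; last by rewrite size_map.
    by apply: (cp_inj lw); rewrite -(last_map (cp w)) pK -ez0.
  have hR : has (predC R) p by rewrite has_predC.
  have [q1 [v1 [r [ep nRv1 Rq1]]]] : exists q1 v1 r, [/\ p = q1 ++ v1 :: r, ~~ R v1 & all R q1].
    case: (split_find hR) => v q1 r nv nq; exists q1, v, r; rewrite cat_rcons; split=> //.
    by move: nq; rewrite has_predC negbK.
  have lr : last v1 r = x0 by move: lx; rewrite ep last_cat.
  have hr : has R r.
    apply/hasP; exists x0 => //; rewrite -lr; case: (lastP r) lr => [/= e|r' u _];
      first by rewrite e Rx0 in nRv1.
    by rewrite last_rcons mem_rcons mem_head.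
  have [q2 [y [q3 [er Ry nRq2]]]] : exists q2 y q3, [/\ r = q2 ++ y :: q3, R y & ~~ has R q2].
    by case: (split_find hr) => v q1' r' nv nq; exists q1', v, r'; rewrite cat_rcons.
  pose u := last x0 q1; pose p2 := v1 :: rcons q2 y.
  have epp : p = q1 ++ p2 ++ q3 by rewrite ep er /p2 /= cat_rcons.
  have Ru : R u by rewrite /u; case: (lastP q1) Rq1 => // s' v;
    rewrite all_rcons last_rcons => /andP[].
  move: (px); rewrite epp !cat_path => /and3P[pa1 pa2 pa3].
  have ly : last u p2 = y by rewrite /p2 /= last_rcons.
  rewrite -/u in pa2 pa3; rewrite ly in pa3.
  have Lu : isl u.
    by have := pa2; rewrite /p2 /= => /andP[uv _]; apply: exitl uv Ru nRv1.
  have Ly : isl y.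
    move: pa2; rewrite /p2 /= rcons_path => /and3P[_ _ ny].
    have nl : ~~ R (last v1 q2).
      case: (lastP q2) nRq2 => // s' v; rewrite has_rcons last_rcons negb_or => /andP[] //.
    have : adj (@plab V Q') y (last v1 q2) by rewrite /adj sy.
    by move=> h; apply: exitl h Ry nl.
  have q1n : 0 < size q1 by rewrite lt0n; apply/negP => /eqP/size0nil e; move: Lu; rewrite /u e.
  have lq3 : last y q3 = x0 by move: lr; rewrite er last_cat.
  have q3n : 0 < size q3 by rewrite lt0n; apply/negP => /eqP/size0nil e; move: Ly lq3;
    rewrite e /= => + ey; rewrite ey.
  have sz : size q1 + size p2 + size q3 <= k.+1 by move: sp; rewrite epp !size_cat addnA.
  have sp2 : 2 <= size p2 by rewrite /p2 /= size_rcons.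
  have projW := fun x p => @walk_map Q' V (@plab V Q') labV (@pproj V Q') x p step_proj.
  have [b1 l1] := projW _ _ pa1.
  have [b2 l2] := projW _ _ pa2.
  have [b3 l3] := projW _ _ pa3.
  have rgW := fun x p => @labs_labels P Q' (@plab V Q') x p rg.
  have a1 := labels_le (rgW _ _ pa1). have a2 := labels_le (rgW _ _ pa2).
  have zp2 : size p2 < k by clear -sz q1n q3n; lia.
  have z13 : size q1 + size q3 < k by clear -sz sp2; lia.
  have islP v : isl v -> exists a phi, v = inl (a, phi) by case: v => // -[a phi] _; exists a, phi.
  have [a [phi eu]] := islP _ Lu; have [b [psi ey]] := islP _ Ly.
  have pu : pproj u = al a by rewrite eu.
  have py : pproj y = al b by rewrite ey.
  have lu : last (pproj x0) (map (@pproj V Q') q1) = al a by rewrite last_map -/u pu.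
  have lp2 : last (al a) (map (@pproj V Q') p2) = al b by rewrite -pu last_map ly py.
  have lp3 : last (al b) (map (@pproj V Q') q3) = pproj x0 by rewrite -py last_map lq3.
  rewrite pu in b2 l2; rewrite py in b3 l3.
  rewrite !labs_cat -/u ly -l1 -l2 -l3; rewrite -l1 in a1; rewrite -l2 in a2.
  have dab : fdist a b <= delta P.
    have [->|/eqP ne] := eqVneq a b; first by rewrite (proj2 (d0 _ _)).
    by case: AA => /(_ _ _ ne)/andP[].
  apply: (@lsum_insert P M nP _ _ _ (fdist a b)) => //.
    (* If [a = b], both crossing vertices project to one vertex of [V]; the walk is cut there, and 0
       takes the role of the label of the cutting edge. *)
    have [eab|nab] := eqVneq a b.
      rewrite eab (proj2 (d0 _ _)) // -eab; apply: consV => //; first by rewrite lp2 eab.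
      by rewrite size_map ltnW.
    apply/(lsum_cons0 nP _ dab); rewrite -cat1s; apply: (lsum_rot nP) => //;
      first by rewrite /= dab.
    have := @consV (al a) (map (@pproj V Q') p2 ++ [:: al a]).
    have eba : labV (al b) (al a) = Some (fdist a b) by rewrite symV al_iso.
    by rewrite cat_path b2 last_cat labs_cat lp2 /= {1}/adj eba /= size_cat size_map /= addn1;
      apply.
  have [eab|nab] := eqVneq a b.
    rewrite eab (proj2 (d0 _ _)) //.
    have : lsum P (labs labV (pproj x0) (map (@pproj V Q') q1) ++ labs labV (al b) (map (@pproj V
      Q') q3)) 0.
      have := @consV (pproj x0) (map (@pproj V Q') q1 ++ map (@pproj V Q') q3).
      by rewrite cat_path b1 last_cat labs_cat lu eab lp3 b3 size_cat !size_map; apply=> //; apply: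
        ltnW.
    case/(lsum_cat nP _ _ a1) => _ [e1 [e2 [h1 h2 h3]]].
    apply/(lsum_cat nP _ _ a1); split=> //; exists e1, e2; split=> //.
    have he2 := lsum_le h2; split=> //; exists e2 => //; by rewrite (compat00 nP).
  have := @consV (pproj x0) (map (@pproj V Q') q1 ++ al b :: map (@pproj V Q') q3).
  rewrite cat_path b1 last_cat labs_cat lu /= {1}/adj al_iso //= b3 lp3 size_cat /= !size_map.
  by rewrite addnS; apply.
move=> x p px lx sp.
have [ax|nax] := boolP (all isl (x :: p)); first exact: Hin.
(* Whether 0 lies in the sum of a closed walk does not depend on its starting point, so the walk may
   be started outside the power. *)
have /hasP[v vp nv] : has (predC isl) (x :: p) by rewrite has_predC.
have [p1 [p2 [ep lv]]] : exists p1 p2, p = p1 ++ p2 /\ last x p1 = v.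
  move: vp; rewrite in_cons => /orP[/eqP->|/splitPr[p1 p2]]; first by exists [::], p.
  by exists (rcons p1 v), p2; rewrite cat_rcons last_rcons.
move: px lx sp; rewrite ep cat_path last_cat labs_cat lv => /andP[px1 px2] lx sp.
have rgW := fun x p => @labs_labels P Q' (@plab V Q') x p rg.
have a1 := labels_le (rgW _ _ px1). have a2 := labels_le (rgW _ _ px2).
apply: (lsum_rot nP) => //.
case: v nv {vp} lv px2 lx a2 => [//|[w z]] _ lv px2 lx a2.
have := @Hout w z (p2 ++ p1); rewrite cat_path px2 lx px1 last_cat lx lv labs_cat lx => h.
by apply: h; rewrite // size_cat addnC -size_cat.
Qed.
End StepInvariants.

(** * Stages without Henson cliques *)

Definition clique (H : mspace) (T : Type) (lab : T -> T -> option nat) (f : H -> T) : Prop :=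
  forall x y, x <> y -> lab (f x) (f y) = Some (mdist x y).

Lemma clique_isometric (H : mspace) (X : finspace) (T : Type) (lab : T -> T -> option nat) (f :
  H -> T) (g : T -> X) :
  clique lab f -> (forall x y d, lab (f x) (f y) = Some d -> d = fdist (g (f x)) (g (f y))) ->
  isometric (@mdist H) (@fdist X) (fun x => g (f x)).
Proof.
move=> cl hg x y; have [dH _ _] := mdistP H; have [dX _ _] := fdistP X.
have [xy|ne] := eqVneq (mdist x y) 0; first by have -> := proj1 (dH _ _) xy;
  rewrite (proj2 (dX _ _)) // (proj2 (dH _ _)).
by rewrite -(hg x y (mdist x y)) //; apply: cl => xy; rewrite xy (proj2 (dH y y)) in ne.
Qed.

Definition Henson_free (S : mspace -> Prop) (T : Type) (lab : T -> T -> option nat) : Prop :=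
  forall H, S H -> forall f : H -> T, ~ clique lab f.

(** Levels replace a linear order, since vertices with the same projection inherit the same level.
    Embedded spaces need strictly increasing levels, and ties are broken only at the end. *)
Record graph := Graph { gvert :> finType; glab : gvert -> gvert -> option nat; glevel : gvert ->
  nat }.

Definition graph_ok (P : params) (k : nat) (G : graph) : Prop :=
  [/\ forall x y : G, glab x y = glab y x, forall (x y : G) d, glab x y = Some d ->
    0 < d <= delta P,
      forall x : G, glab x x = None & consistent P k (@glab G)].

Definition gembedding (B : ordspace) (G : graph) (f : B -> G) : Prop :=
  forall x y, x <> y -> glab (f x) (f y) = Some (fdist x y) /\ (order_of B x y ->
    glevel (f x) < glevel (f y)).

Definition arrow (A B : ordspace) (K : finType) (G : graph) : Prop :=
  forall chi : {ffun A -> G} -> K, exists2 f : {ffun B -> G}, gembedding f &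
    forall e1 e2 : A -> B, oembedding e1 -> oembedding e2 ->
      chi [ffun a => f (e1 a)] = chi [ffun a => f (e2 a)].

Section Stage.
Variables (P : params) (M : nat) (S : mspace -> Prop) (A B : ordspace).
Hypotheses (nP : nice P M) (KA : class_K P S A) (KB : class_K P S B).

Lemma oembedding_neq (e : A -> B) a b : oembedding e -> a != b -> e a != e b.
Proof.
move=> [iso _]; apply: contra_neq => eab; have [dA _ _] := fdistP A; have [dB _ _] := fdistP B.
by apply/dA; rewrite -iso; apply/dB.
Qed.

(** All neighbours of a vertex outside the power lie in its own copy of [Q], so a clique with such a
    vertex pulls back to [Q]. A clique inside the power projects isometrically to [A], which is in
    the class. *)
Lemma step_Henson_free (V : finType) (labV : V -> V -> option nat) (al : A -> V) (I : finType) (Q :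
  picture V) :
  injective al -> (forall a b, a != b -> labV (al a) (al b) = Some (fdist a b)) ->
  pict_wf (delta P) Q -> (forall (x y : Q) d, plab x y = Some d ->
    labV (pproj x) (pproj y) = Some d) ->
  Henson_free S (@plab V Q) -> Henson_free S (@plab V (step_picture Q al I)).
Proof.
move=> al_inj al_iso wfQ projQ HQ H SH f cl.
have [dH _ _] := mdistP H.
have [[h [w [z eh]]]|allin] := classic (exists h w z, f h = inr (w, z)).
  have inR x : x <> h -> isline w /\ exists u v, [/\ f h = cp w u,
    f x = cp w v & plab u v = Some (mdist h x)].
    move=> ne; have := cl h x (fun e => ne (esym e)); rewrite eh /= => /copy_labP[w' [u [v [lw eu
      ev e]]]].
    have [ew _] := cp_inr (esym eu); rewrite ew in lw eu ev *.
    by split=> //; exists u, v.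
  have [sing|/not_all_ex_not[x0 nx0]] := classic (forall x, x = h).
    apply: (HQ H SH (fun=> z)) => x y ne; by case: ne; rewrite (sing x) (sing y).
  have [lw [u0 [_ [e0 _ _]]]] := inR x0 nx0.
  pose g x := odflt u0 [pick u | cp w u == f x].
  have gK x : cp w (g x) = f x.
    rewrite /g; case: pickP => [u /eqP //|no].
    have [->|ne] := classic (x = h); first by rewrite /= -e0.
    by have [_ [u [v [_ ev _]]]] := inR x ne; have := no v; rewrite ev eqxx.
  apply: (HQ H SH g) => x y ne.
  by have := cl x y ne; rewrite -!gK /= (amalgam_lab_cp wfQ al_inj).
have [[h0 _]|emp] := classic (exists h : H, True); last first.
  have ne0 : forall h : H, False by move=> h; apply: emp; exists h.
  by apply: (HQ H SH (fun h => match ne0 h with end)) => x; case: (ne0 x).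
have [[a0 phi0] e0] : exists u, f h0 = inl u.
  by case E: (f h0) => [u|[w z]]; [exists u|case: allin; exists h0, w, z].
pose g (u : step_picture Q al I) : A := if u is inl u then u.1 else a0.
case: KA => _ /(_ H SH); apply; exists (fun x => g (f x)).
apply: (clique_isometric cl) => x y d.
case Ex: (f x) => [u|[w z]]; last by case: allin; exists x, w, z.
case Ey: (f y) => [v|[w z]]; last by case: allin; exists y, w, z.
by case/(power_lab_dist al_iso projQ).
Qed.

(** The partite construction over [G] starts from disjoint copies of [B], which are consistent for
    all lengths and contain no Henson clique, whatever [G] is. Only the amalgamation steps use the
    consistency of [G] up to length [k]. *)
Lemma stage_up (K : finType) (k : nat) (G : graph) : graph_ok P k G -> arrow A B (option K) G ->
  exists G' : graph, [/\ graph_ok P k.+1 G', Henson_free S (@glab G') & arrow A B K G'].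
Proof.
move=> [sy rg ir cons] arr.
have [AA _] := KA; have [AB _] := KB.
pose validB (be : {ffun B -> G}) := [forall x, forall y, (x != y) ==>
  (glab (be x) (be y) == Some (fdist x y)) && (order_of B x y ==> (glevel (be x) < glevel (be y)))].
pose validA (al : {ffun A -> G}) := [forall x, forall y, (x != y) ==> (glab (al x) (al y) == Some
  (fdist x y))].
have vBP be : validB be -> forall x y, x != y -> glab (be x) (be y) = Some (fdist x y) /\
  (order_of B x y -> glevel (be x) < glevel (be y)).
  by move=> /forallP h x y xy; have /forallP/(_ y) := h x; rewrite xy => /andP[/eqP-> /implyP].
have vAP al : validA al -> forall x y, x != y -> glab (al x) (al y) = Some (fdist x y).
  by move=> /forallP h x y xy; have /forallP/(_ y) := h x; rewrite xy => /eqP->.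
have inj_of (T : finspace) (h : T -> G) : (forall x y, x != y ->
  glab (h x) (h y) = Some (fdist x y)) -> injective h.
  by move=> hh x y e; apply/eqP; apply/negPn/negP => /hh; rewrite e ir.
pose Inv (Q : picture G) := [/\ forall (x y : Q) d, plab x y = Some d ->
  glab (pproj x) (pproj y) = Some d,
   consistent P k.+1 (@plab G Q) & Henson_free S (@plab G Q)].
have [||be|al|be e|Q al I|||Q [wfQ [prQ coQ heQ] HQ]] :=
  @ordered_partite G (delta P) A B K Inv validB validA.
- by case: AA.
- by case: AB.
- by move=> /vBP h; apply: inj_of => x y /h[].
- by move=> /vAP; apply: inj_of.
- move=> /vBP h oe; apply/forallP => x; apply/forallP => y; apply/implyP => xy; rewrite !ffunE.
  by have [-> _] := h _ _ (oembedding_neq oe xy); rewrite (proj1 oe).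
- move=> /vAP al_iso wfQ [h1 h2 h3]; have al_inj := inj_of A al al_iso; split.
  + exact: step_proj.
  + exact: (step_consistent nP AA al_inj al_iso wfQ h1 cons h2 sy).
  + exact: step_Henson_free al_inj al_iso wfQ h1 h3.
- split=> [u v d /copies_labP[e va ne ->] /=|x p px lx _|H SH f cl].
  + by rewrite -e; have [] := vBP _ va _ _ ne.
  + have := walk_metric (f := fun u : copies validB => u.2) nP AB _ px.
    rewrite lx; have [d0 _ _] := fdistP B; rewrite (proj2 (d0 _ _)) //; apply.
    by move=> u v d /copies_labP[].
  + case: KB => _ /(_ H SH); apply; exists (fun x => (f x).2).
    by apply: (clique_isometric (g := fun u : copies validB => u.2) cl) => x y d /copies_labP[].
- move=> chi; have [f fe fm] := arr chi; exists f => //.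
  apply/forallP => x; apply/forallP => y; apply/implyP => /eqP xy; have [-> h] := fe x y xy.
  by rewrite eqxx; apply/implyP.
have [syQ rgQ paQ] := wfQ.
exists (@Graph Q (@plab G Q) (fun x => glevel (pproj x))); split=> //.
  split=> //= x; case E: (plab x x) => [d|//]; by have := paQ _ _ _ E; rewrite eqxx.
move=> chi; have [f [f1 f2 f3]] := HQ chi; exists f => // x y /eqP xy /=; split; first exact: f1.
by have [_] := vBP _ f2 x y xy; rewrite !ffunE.
Qed.

(** * Increasing maps and the base stage *)

Definition incr (T : ordspace) (N : nat) (h : T -> 'I_N) := forall x y, x != y -> order_of T x y ->
  h x < h y.

Definition rank (T : ordspace) (x : T) := #|[set y : T | order_of T y x & y != x]|.

Lemma rank_lt (T : ordspace) (x y : T) : x != y -> order_of T x y -> rank x < rank y.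
Proof.
have [tr an] := (@lo_trans _ (order_of T), @lo_anti _ (order_of T)).
move=> xy oxy; apply: proper_card; apply/properP; split.
  apply/subsetP => z; rewrite !inE => /andP[ozx zx]; rewrite (tr _ _ _ ozx oxy) /=.
  by apply: contra_neq zx => zy; apply: an; rewrite ozx zy oxy.
by exists x; rewrite !inE ?eqxx ?andbF // oxy xy.
Qed.

Lemma rank_max (T : ordspace) (x : T) : rank x < #|T|.
Proof.
rewrite -cardsT; apply: proper_card; apply/properP; split; first exact: subsetT.
by exists x; rewrite !inE ?eqxx ?andbF.
Qed.

Lemma incr_neq (T : ordspace) N (h : T -> 'I_N) x y : incr h -> x != y ->
  (order_of T x y = (h x < h y)) /\ h x != h y.
Proof.
move=> ih xy; have /orP[o|o] := @lo_total _ (order_of T) x y.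
  have l := ih _ _ xy o; by rewrite o l; split=> //; apply: contraTneq l => ->; rewrite ltnn.
rewrite eq_sym in xy; have l := ih _ _ xy o; split; last by apply: contraTneq l => ->; rewrite ltnn.
rewrite ltnNge (ltnW l) /=; apply/negP => o'; move/eqP: xy; apply.
by apply: (@lo_anti _ (order_of T)); rewrite o o'.
Qed.

Lemma incr_rank (T : ordspace) N (h : T -> 'I_N) (Z : {set 'I_N}) x : incr h -> h @: T = Z ->
  #|[set z in Z | z < h x]| = rank x.
Proof.
move=> ih <-; rewrite /rank -(card_imset (f := h)).
  apply: eq_card => z; rewrite inE; apply/andP/imsetP => [[/imsetP[y _ ->] l]|[y + ->]].
    have yx : y != x by apply: contraTneq l => ->; rewrite ltnn.
    by exists y => //; rewrite inE yx andbT (proj1 (incr_neq ih yx)).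
  rewrite inE => /andP[o yx]; split; first exact: imset_f.
  exact: ih.
move=> y z e; apply/eqP/negPn/negP => yz; by have [_] := incr_neq ih yz; rewrite e eqxx.
Qed.

(** An increasing map is determined by its image, because the rank of a point counts the smaller
    elements of the image. So a colouring of increasing maps is a colouring of sets, as Ramsey's
    theorem requires. *)
Lemma incr_uniq (T : ordspace) N (h1 h2 : T -> 'I_N) : incr h1 -> incr h2 -> h1 @: T = h2 @: T ->
  h1 =1 h2.
Proof.
move=> i1 i2 e.
have H (g1 g2 : T -> 'I_N) x : incr g1 -> incr g2 -> g1 @: T = g2 @: T -> ~~ (g1 x < g2 x).
  move=> j1 j2 eg; apply/negP => l.
  have := incr_rank x j1 erefl; rewrite -(incr_rank x j2 (esym eg)) => ec.
  suff : #|[set z in g1 @: T | z < g1 x]| < #|[set z in g1 @: T | z < g2 x]| by rewrite ec ltnn.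
  apply: proper_card; apply/properP; split.
    by apply/subsetP => z; rewrite !inE => /andP[-> /ltn_trans->].
  by exists (g1 x); rewrite !inE ?ltnn ?andbF // imset_f.
by move=> x; apply/val_inj/eqP; rewrite eqn_leq; apply/andP; split; rewrite leqNgt; apply: H.
Qed.

Lemma incr_exists (T : ordspace) N (Y : {set 'I_N.+1}) : #|Y| = #|T| -> exists2 h : {ffun T ->
  'I_N.+1}, incr h & h @: T \subset Y.
Proof.
move=> cY; exists [ffun x => nth ord0 (enum Y) (rank x)].
  move=> x y xy o; rewrite !ffunE.
  have srt : sorted ltn (map val (enum Y)).
    apply: (subseq_sorted ltn_trans (s2 := map val (enum 'I_N.+1)));
      last by rewrite val_enum_ord iota_ltn_sorted.
    by apply: map_subseq; rewrite enumT /enum_mem; apply: filter_subseq.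
  have sz (z : T) : rank z < size (enum Y) by rewrite -cardE cY; exact: rank_max.
  rewrite -!(nth_map ord0 0 val) //; apply: (sorted_ltn_nth ltn_trans) => //;
    rewrite ?inE ?size_map //.
  exact: rank_lt.
apply/subsetP => _ /imsetP[x _ ->]; rewrite ffunE -mem_enum; apply: mem_nth.
by rewrite -cardE cY; exact: rank_max.
Qed.

(** Ramsey's theorem provides positions without labels; copies of [B] are placed over increasing
    positions, and the partite construction is run with a trivial invariant. Consistency up to
    length 1 needs only the absence of loops. *)
Lemma stage_base (K : finType) : exists2 G : graph, graph_ok P 1 G & arrow A B K G.
Proof.
have [AA _] := KA; have [AB _] := KB.
have [N HN] := Ramsey_sets (option (option K)) #|A| #|B|.
pose validB (be : {ffun B -> 'I_N.+1}) := [forall x, forall y,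
  (x != y) ==> order_of B x y ==> (be x < be y)].
pose validA (al : {ffun A -> 'I_N.+1}) := [forall x, forall y,
  (x != y) ==> order_of A x y ==> (al x < al y)].
have vBP (be : {ffun B -> 'I_N.+1}) : reflect (incr be) (validB be).
  apply: (iffP forallP) => [h x y xy o|h x]; first by have /forallP/(_ y) := h x; rewrite xy o.
  by apply/forallP => y; apply/implyP => xy; apply/implyP; apply: h.
have vAP (al : {ffun A -> 'I_N.+1}) : reflect (incr al) (validA al).
  apply: (iffP forallP) => [h x y xy o|h x]; first by have /forallP/(_ y) := h x; rewrite xy o.
  by apply/forallP => y; apply/implyP => xy; apply/implyP; apply: h.
have inj_of (T : ordspace) (h : T -> 'I_N.+1) : incr h -> injective h.
  by move=> ih y z e; apply/eqP/negPn/negP => yz; have [_] := incr_neq ih yz; rewrite e eqxx.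
have comp (be : B -> 'I_N.+1) (e : A -> B) : incr be -> oembedding e -> incr (fun a => be (e a)).
  by move=> ib oe x y xy o; apply: ib; [exact: oembedding_neq|rewrite (proj2 oe)].
have [||be|al|be e||||Q [wfQ _ HQ]] :=
  @ordered_partite 'I_N.+1 (delta P) A B K (fun=> True) validB validA => //.
- by case: AA.
- by case: AB.
- by move=> /vBP/inj_of.
- by move=> /vAP/inj_of.
- by move=> /vBP ib oe; apply/vAP => x y xy o; rewrite !ffunE; apply: comp.
- move=> chi.
  pose chi' (Z : {set 'I_N.+1}) := omap chi [pick al | validA al & al @: A == Z].
  have [Y [_ cY mY]] := HN 'I_N.+1 setT chi' ltac:(by rewrite cardsT card_ord leqnSn).
  have [be ib sb] := incr_exists cY; exists be; first exact/vBP.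
  have E (e : A -> B) : oembedding e -> exists Z : {set 'I_N.+1}, [/\ Z \subset Y, #|Z| = #|A|
    & chi' Z = Some (chi [ffun a => be (e a)])].
    move=> oe; have ie : incr [ffun a => be (e a)] by move=> x y xy o; rewrite !ffunE; apply: comp.
    exists ([ffun a => be (e a)] @: A); split.
    + apply/subsetP => _ /imsetP[a _ ->]; rewrite ffunE; apply: (subsetP sb); exact: imset_f.
    + by rewrite card_imset //; apply: inj_of.
    rewrite /chi'; case: pickP => [al /andP[/vAP ia /eqP im]|no] /=.
      by congr (Some (chi _)); apply/ffunP; apply: incr_uniq.
    by have := no [ffun a => be (e a)]; rewrite eqxx andbT; move/vAP.
  move=> e1 e2 /E[Z1 [s1 c1 h1]] /E[Z2 [s2 c2 h2]].
  by apply: Some_inj; rewrite -h1 -h2; apply: mY.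
have [syQ rgQ paQ] := wfQ.
have ir (x : Q) : plab x x = None by case E: (plab x x) => [d|//]; have := paQ _ _ _ E;
  rewrite eqxx.
exists (@Graph Q (@plab _ Q) (fun x => val (pproj x))).
  by split=> //= x [|y [|]] //=; rewrite /adj andbT => + e; rewrite e ir.
move=> chi; have [f [f1 f2 f3]] := HQ chi; exists f => // x y /eqP xy /=; split; first exact: f1.
by move=> o; have := vBP _ f2 x y xy o; rewrite !ffunE.
Qed.
End Stage.

(** * Completion to a metric space *)

Section Completion.
Variables (P : params) (M : nat).
Hypothesis nP : nice P M.
Notation dl := (delta P).
Variable T : finType.
Implicit Types lab : T -> T -> option nat.

Definition lab_ok lab : Prop :=
  [/\ forall x y, lab x y = lab y x, forall x y d, lab x y = Some d -> 0 < d <= dl,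
      forall x, lab x x = None & forall n, consistent P n lab].

Lemma lsum_rev l c : all (fun a => a <= dl) l -> lsum P (rev l) c -> lsum P l c.
Proof.
elim: l c => //= a l IH c /andP[ha hl].
rewrite rev_cons -cats1; case/(lsum_cat nP); first by rewrite all_rev.
move=> hc [e1 [e2 [h1 /(lsum1 nP _ ha) -> h3]]]; split=> //; exists e1; first exact: IH.
by rewrite compat_swap.
Qed.

Lemma walk_rev lab (x : T) p : (forall x y, lab x y = lab y x) -> path (adj lab) x p ->
  path (adj lab) (last x p) (rev (belast x p)) /\ labs lab (last x p) (rev (belast x p)) = rev
    (labs lab x p).
Proof.
move=> sy; elim: p x => //= y p IH x /andP[xy /IH[h1 h2]].
have l0 : last (last y p) (rev (belast y p)) = y by case: (p) => //= z q;
  rewrite rev_cons last_rcons.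
rewrite !rev_cons -!cats1 cat_path labs_cat h1 h2 l0 /= andbT; split; first by rewrite /adj sy.
by rewrite /labs /= sy.
Qed.

Section AddEdge.
Variables (lab : T -> T -> option nat) (u v : T).
Hypotheses (ok : lab_ok lab) (uv : u != v) (luv : lab u v = None).

Definition new_edge (x y : T) : bool := ((x == u) && (y == v)) || ((x == v) && (y == u)).
Definition add_edge (c : nat) (x y : T) : option nat := if new_edge x y then Some c else lab x y.

Lemma new_edge_sym x y : new_edge x y = new_edge y x.
Proof. by rewrite /new_edge orbC andbC (andbC (x == u)). Qed.

Lemma walk_split c x p : path (adj (add_edge c)) x p ->
  (path (adj lab) x p /\ labs (add_edge c) x p = labs lab x p) \/
  exists p1 z p2, p = p1 ++ z :: p2 /\ new_edge (last x p1) z.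
Proof.
elim: p x => [|y p IH] x /=; first by left.
case/andP=> xy py; have [n|n] := boolP (new_edge x y); first by right; exists [::], y, p.
have [[h1 h2]|[p1 [z [p2 [e h]]]]] := IH y py; last by right; exists (y :: p1), z, p2; rewrite e.
left; split; last by rewrite h2 /add_edge (negPf n).
by move: xy; rewrite /adj /add_edge (negPf n) => ->.
Qed.

(** A walk from [u] to [v] followed by the reverse of another one is closed, so the sums of the two
    meet. The Helly property then gives a label common to all walks. *)
Lemma common_label : exists2 c, 0 < c <= dl &
  forall p, path (adj lab) u p -> last u p = v -> lsum P (labs lab u p) c.
Proof.
have [sy rg ir co] := ok.
have [|l l' [p [h1 h2 ->]] [p' [h1' h2' ->]]|c hc Hc] :=
  @lsum_helly P M nP (fun l => exists p, [/\ path (adj lab) u p, last u p = v & l = labs lab u p]).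
- move=> l [p [h1 h2 ->]]; split; first exact: labs_labels.
  by case: p h2 {h1} => //= e; move: uv; rewrite e eqxx.
- have [] := walk_rev sy h1'; rewrite h2' => r1 r2.
  have := co (size (p ++ rev (belast u p'))) u (p ++ rev (belast u p'));
    rewrite cat_path h1 last_cat h2 r1 labs_cat h2 r2.
  have -> : last v (rev (belast u p')) = u.
    by case: (p') h2' => //= z q _; rewrite rev_cons last_rcons.
  move=> /(_ isT erefl (leqnn _)).
  have hle := labels_le (labs_labels rg h1); have hle' := labels_le (labs_labels rg h1').
  case/(lsum_cat nP _ _ hle) => _ [e1 [e2 [s1 s2]]].
  rewrite -compat_rot (compat00 nP) ?(lsum_le s1) // => /eqP e; exists e1 => //.
  by apply: lsum_rev => //; rewrite e.
by exists c => // p h1 h2; apply: Hc; exists p.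
Qed.

(** Induction on the length of a closed walk. Started with the new edge, the rest of the walk must
    have [c] in its sum; this is the hypothesis if the new edge does not recur, and otherwise the
    walk splits into shorter closed ones. *)
Lemma add_edge_ok c : 0 < c <= dl ->
  (forall p, path (adj lab) u p -> last u p = v -> lsum P (labs lab u p) c) -> lab_ok (add_edge c).
Proof.
move=> hc Hc; have [sy rg ir co] := ok.
have cd : c <= dl by case/andP: hc.
have sy' x y : add_edge c x y = add_edge c y x by rewrite /add_edge new_edge_sym sy.
have rg' x y d : add_edge c x y = Some d -> 0 < d <= dl.
  by rewrite /add_edge; case: ifP => _ => [[<-]|/rg].
split=> // [x|n].
  rewrite /add_edge /new_edge; case: eqP => [->|_] /=; first by rewrite (negPf uv) ir.
  by rewrite andbF ir.
suff key m x p : size p < m -> path (adj (add_edge c)) x p -> last x p = x ->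
  lsum P (labs (add_edge c) x p) 0.
  by move=> x p px lx _; apply: key (ltnSn _) px lx.
elim: m x p {n} => // m IH x p sm px lx.
have [[h1 ->]|[p1 [z [p2 [ep nw]]]]] := walk_split px; first exact: (co (size p)).
set t := last x p1 in nw.
have hle y q : path (adj (add_edge c)) y q -> all (fun a => a <= dl) (labs (add_edge c) y q).
  by move=> h; apply: labels_le; apply: labs_labels h.
have IH' y q : size q < size p -> path (adj (add_edge c)) y q -> last y q = y ->
  lsum P (labs (add_edge c) y q) 0.
  by move=> sq py ly; apply: IH => //; apply: leq_trans sq _.
have etz : add_edge c t z = Some c by rewrite /add_edge nw.
move: px lx; rewrite ep cat_path last_cat /= -/t => /and3P[px1 _ px2] lx.
pose q := p2 ++ p1.
have pq : path (adj (add_edge c)) z q by rewrite cat_path px2 lx.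
have lq : last z q = t by rewrite last_cat lx.
have sq : size p = (size q).+1 by rewrite ep /q !size_cat /= addnS addnC.
suff Hq : lsum P (labs (add_edge c) z q) c.
  rewrite labs_cat /= -/t; apply: (lsum_rot nP); last 1 first.
  - rewrite -cat1s /= etz /= -/(labs _ _ _); move: Hq; rewrite /q labs_cat lx => Hq.
    by apply/(lsum_cons0 nP).
  - by rewrite /= etz /= cd hle.
  - exact: hle.
have [tz zt] : (t == z) = false /\ forall s z', new_edge s z' -> (s = t /\ z' = z) \/ (s = z /\
  z' = t).
  move: nw; rewrite /new_edge => /orP[] /andP[/eqP-> /eqP->]; split.
  - exact: negPf uv.
  - by move=> s z' /orP[] /andP[/eqP-> /eqP->]; [left|right].
  - by rewrite eq_sym (negPf uv).
  - by move=> s z' /orP[] /andP[/eqP-> /eqP->]; [right|left].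
have [[h1 h2]|[q1 [z' [q2 [eq nw']]]]] := walk_split pq.
  rewrite h2; case/orP: (nw) => /andP[/eqP tu /eqP zv].
    have [r1 r2] := walk_rev sy h1; rewrite lq tu in r1 r2.
    apply: lsum_rev; first exact: labels_le (labs_labels rg h1).
    rewrite -r2; apply: Hc => //; case: (q) lq => [/= e|w q' _]; first by rewrite -tu -e zv.
    by rewrite /= rev_cons last_rcons zv.
  by rewrite zv in h1 lq *; apply: Hc => //; rewrite lq.
move: pq lq; rewrite eq cat_path last_cat /= => /and3P[pq1 e12 pq2] lq.
have s1 : size q1 + size q2 < size q by rewrite eq size_cat /= addnS.
have e12c : add_edge c (last z q1) z' = Some c by rewrite /add_edge nw'.
rewrite labs_cat /= e12c /= -/(labs _ _ _).
apply/(lsum_cat nP _ _ (hle _ _ pq1)); split=> //.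
(* If the edge recurs in the same direction, [q1] and [q2] both lead from [z] to [t], and each forms
   a shorter closed walk with the new edge. In the opposite direction [q1] and [q2] are themselves
   closed. *)
have [[ls lz']|[ls lz']] := zt _ _ nw'.
  have c1 : lsum P (labs (add_edge c) z q1) c.
    apply/(lsum_cons0 nP _ cd); have := IH' t (z :: q1); rewrite /= {1}/adj etz /= ls; apply=> //.
    by rewrite sq ltnS; apply: leq_ltn_trans s1; apply: leq_addr.
  have c2 : lsum P (labs (add_edge c) z q2) c.
    apply/(lsum_cons0 nP _ cd); have := IH' t (z :: q2); rewrite /= {1}/adj etz /= -lz' lq;
      apply=> //.
    by rewrite sq ltnS; apply: leq_ltn_trans s1; apply: leq_addl.
  exists c, 0; split=> //; last by rewrite compat_swap (compat00 nP).
  by rewrite lz'; apply/(lsum_cons0 nP).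
exists 0, c; split; last by rewrite (compat00 nP).
  apply: IH' => //; rewrite sq ltnS; apply: ltnW; apply: leq_ltn_trans s1; apply: leq_addr.
split=> //; exists 0; last by rewrite compat_swap (compat00 nP).
apply: IH' => //; last by rewrite lz' in lq *.
rewrite sq ltnS; apply: ltnW; apply: leq_ltn_trans s1; apply: leq_addl.
Qed.
End AddEdge.

Lemma complete_lab lab : lab_ok lab -> exists lab', [/\ lab_ok lab',
  forall x y d, lab x y = Some d -> lab' x y = Some d & forall x y, x != y -> lab' x y].
Proof.
have [n] : exists n, #|[set p : T * T | (p.1 != p.2) && ~~ lab p.1 p.2]| <= n by eexists; exact:
  leqnn.
elim: n lab => [|n IH] lab hn ok.
  exists lab; split=> // x y xy; apply/negPn/negP => nl.
  move: hn; rewrite leqn0 cards_eq0 => /eqP/setP/(_ (x, y)); by rewrite !inE /= xy nl.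
have [[u v] huv|none] := pickP (fun p : T * T => (p.1 != p.2) && ~~ lab p.1 p.2); last first.
  by exists lab; split=> // x y xy; have := none (x, y); rewrite /= xy => /negbFE.
have /andP[/= uv luv] := huv.
have luv' : lab u v = None by case: (lab u v) luv.
have [c hc Hc] := common_label ok uv.
have ok' := add_edge_ok ok uv hc Hc.
have ext x y d : lab x y = Some d -> add_edge lab u v c x y = Some d.
  rewrite /add_edge /new_edge; case: ifP => // /orP[] /andP[/eqP-> /eqP->]; first by rewrite luv'.
  by case: ok => sy _ _ _; rewrite sy luv'.
have [|lab' [h1 h2 h3]] := IH _ _ ok'.
  rewrite -ltnS; apply: leq_trans hn; apply: proper_card; apply/properP; split.
    apply/subsetP => -[x y]; rewrite !inE /= => /andP[-> /=]; apply: contra.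
    by case E: (lab x y) => [d|] // _; rewrite (ext _ _ _ E).
  by exists (u, v); rewrite !inE /= uv ?luv // /add_edge /new_edge !eqxx.
by exists lab'; split=> // x y d /ext/h2.
Qed.
End Completion.

(** * From labellings to spaces, and replacement of the distances 1 and delta *)

Section Distances.
Variables (P : params) (M : nat).
Hypothesis nP : nice P M.
Notation dl := (delta P).

(** A walk longer than the bound of [lsum_full] has every label in its sum, in particular 0. Thus
    finitely many stages suffice. *)
Lemma long_consistent : exists n0, forall (T : finType) (lab : T -> T -> option nat),
  (forall x y d, lab x y = Some d -> 0 < d <= dl) -> consistent P n0 lab -> forall n,
    consistent P n lab.
Proof.
have [n0 H] := lsum_full nP; exists n0 => T lab rg co n x p px lx _.
have [h|h] := leqP (size p) n0; first exact: co.
by apply: H => //; [exact: labs_labels px | rewrite /labs size_pairmap ltnW].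
Qed.

Definition dist_ok (T : eqType) (D : T -> T -> nat) : Prop :=
  [/\ forall x y, (D x y == 0) = (x == y), forall x y, D x y = D y x, forall x y, D x y <= dl
    & forall x y z, compat P (D x y) (D y z) (D x z)].

Lemma complete_dist (T : finType) (lab : T -> T -> option nat) : lab_ok P lab ->
  exists D : T -> T -> nat, dist_ok D /\ forall x y d, lab x y = Some d -> D x y = d.
Proof.
move=> ok; have [_ _ ir0 _] := ok; have [lab' [[sy rg ir co] ext tot]] := complete_lab nP ok.
pose D (x y : T) := odflt 0 (lab' x y).
have D0 x : D x x = 0 by rewrite /D ir.
have Dsy x y : D x y = D y x by rewrite /D sy.
have Dle x y : D x y <= dl by rewrite /D; case E: (lab' x y) => [d|] //=; case/andP: (rg _ _ _ E).
exists D; split=> [|x y d /ext]; last by rewrite /D => ->.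
split=> // [x y|x y z].
  have [->|xy] := eqVneq x y; first by rewrite D0.
  by have := tot _ _ xy; rewrite /D; case E: (lab' x y) => [d|] //= _; have := rg _ _ _ E; case:
    d {E}.
have [->|xy] := eqVneq x y; first by rewrite D0 (compat00 nP).
have [->|yz] := eqVneq y z; first by rewrite D0 compat_swap (compat00 nP).
have [<-|xz] := eqVneq x z; first by rewrite D0 -compat_rot (compat00 nP) // Dsy.
have : lsum P [:: D x y; D y z; D z x] 0.
  by apply: (co 3 x [:: y; z; x]) => //=; rewrite /adj !tot // eq_sym.
case/(lsum_cons0 nP _ (Dle x y)) => _ [e /(lsum1 nP _ (Dle z x)) ->].
by rewrite -compat_rot (Dsy z x).
Qed.

Lemma change_dist (T : finType) (D : T -> T -> nat) (u v : T) : dist_ok D -> u != v -> D u v = 1 \/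
  D u v = dl ->
  exists D', [/\ dist_ok D', 1 < D' u v < dl, D' v u = D' u v & forall x y, ((x, y) != (u,
    v)) && ((x, y) != (v, u)) -> D' x y = D x y].
Proof.
move=> [D0 Dsy Dle Dc] uv hD; have [kap [tie [h h']]] := nP.
have [t ht Ht] : exists2 t, 1 < t < dl & forall w, w != u -> w != v -> compat P (D u w) (D w v) t.
  have Dp (x y : T) : x != y -> (1 <= zn (D x y) <= zn dl)%Z.
    by have := D0 x y; have := Dle x y; case: eqP => //; lia.
  have cw w : compat P (D u w) (D w v) (D u v) by [].
  case: hD => hD.
    have [all2|/not_all_ex_not[w0 nw0]] := classic (forall w, w != u -> w != v ->
      compat P (D u w) (D w v) 2).
      by exists 2 => //; have := nice_d nP; lia.
    have {nw0} [w0u w0v n2] : [/\ w0 != u, w0 != v & ~ compat P (D u w0) (D w0 v) 2].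
      have [e|w0u] := eqVneq w0 u; first by case: nw0; rewrite e eqxx.
      have [e|w0v] := eqVneq w0 v; first by case: nw0; rewrite e eqxx.
      by split=> // n2; apply: nw0.
    have H w : w != u -> w != v -> 3 < dl /\ compat P (D u w) (D w v) 3.
      move=> wu wv.
      have [uw uw0] : u != w /\ u != w0 by rewrite !(eq_sym u).
      have [|||||||||h2|[h3 h4]] := avoid_one _ _ _ _ _ _ _ _ h h' (zn (D u w0)) (zn (D w0 v)) (zn
        (D u w)) (zn (D w v)) (zn (D w0 w)); try exact: Dp.
      - by have := Dle w0 w; lia.
      - by have /compatP := cw w0; rewrite hD.
      - by have /compatP := cw w; rewrite hD.
      - by apply/compatP; rewrite -compat_rot compat_swap.
      - by apply/compatP; rewrite compat_swap -compat_rot.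
      - by case: n2; apply/(compatP P _ _ 2).
      - by split; [lia|apply/(compatP P _ _ 3)].
    exists 3 => [|w wu wv]; last by case: (H w wu wv).
    by have [] := H w0 w0u w0v; lia.
  have [t [ht Ht]] := avoid_delta _ _ _ _ _ _ _ _ h h'.
  exists (Z.to_nat t) => [|w wu wv]; first lia.
  apply/compatP; rewrite Z2Nat.id; last lia.
  apply: Ht; [by rewrite eq_sym in wu; exact: Dp|exact: Dp|].
  by apply/compatP; rewrite -hD.
pose D' x y := if ((x, y) != (u, v)) && ((x, y) != (v, u)) then D x y else t.
have D'v x y : ((x, y) != (u, v)) && ((x, y) != (v, u)) -> D' x y = D x y by rewrite /D' => ->.
have D'uv : D' u v = t by rewrite /D' eqxx.
have D'vu : D' v u = t by rewrite /D' eqxx andbF.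
have /andP[t1 td] := ht.
have D'0 x y : (D' x y == 0) = (x == y).
  rewrite /D'; case: ifP => // /negbT; rewrite negb_and !negbK => /orP[] /eqP[-> ->];
    rewrite ?(eq_sym v) (negPf uv); lia.
have D'sy x y : D' x y = D' y x.
  by rewrite /D' Dsy !xpair_eqE andbC (andbC (y == u)) (andbC (y == v)).
have D'le x y : D' x y <= dl by rewrite /D'; case: ifP => // _; exact: ltnW.
exists D'; rewrite D'uv D'vu; split=> //; split=> // x y z.
have D'xx w : D' w w = 0 by apply/eqP; rewrite D'0.
have [->|xy] := eqVneq x y; first by rewrite D'xx (compat00 nP).
have [->|yz] := eqVneq y z; first by rewrite D'xx compat_swap (compat00 nP).
have [<-|xz] := eqVneq x z; first by rewrite D'xx -compat_rot (compat00 nP) // D'sy.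
have key p q r : p != q -> q != r -> p != r -> ~~ (((p, q) != (u, v)) && ((p, q) != (v, u))) ->
    compat P (D' p q) (D' q r) (D' p r).
  move=> pq qr pr; rewrite negb_and !negbK => /orP[] /eqP[ep eq].
    rewrite ep eq in qr pr *; rewrite eq_sym in qr; rewrite eq_sym in pr.
    rewrite D'uv !D'v ?xpair_eqE ?(negPf pr) ?(negPf qr) ?andbF ?(negPf uv) //.
    by rewrite compat_rot compat_swap (Dsy v); apply: Ht.
  rewrite ep eq in qr pr *; rewrite eq_sym in qr; rewrite eq_sym in pr.
  rewrite D'vu !D'v ?xpair_eqE ?(negPf pr) ?(negPf qr) ?andbF ?(negPf uv) //.
  by rewrite compat_rot (Dsy v); apply: Ht.
have [hxy|/key] := boolP (((x, y) != (u, v)) && ((x, y) != (v, u))); last exact.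
have [hyz|/key h1] := boolP (((y, z) != (u, v)) && ((y, z) != (v, u))); last first.
  by rewrite compat_rot (D'sy x z) (D'sy x y); apply: h1; rewrite // eq_sym.
have [hxz|/key h1] := boolP (((x, z) != (u, v)) && ((x, z) != (v, u))); last first.
  by rewrite -compat_rot compat_swap -compat_rot compat_swap (D'sy y z) -compat_rot compat_swap
    compat_rot; apply: h1; rewrite // eq_sym.
by rewrite !D'v.
Qed.

Lemma avoid_extremes (T : finType) (lab : T -> T -> option nat) (D : T -> T -> nat) :
  (forall x y, lab x y = lab y x) -> dist_ok D -> (forall x y d, lab x y = Some d -> D x y = d) ->
  exists D' : T -> T -> nat, [/\ dist_ok D', forall x y d, lab x y = Some d -> D' x y = d &
    forall x y, x != y -> D' x y = 1 \/ D' x y = dl -> lab x y].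
Proof.
move=> sy; pose bad (D : T -> T -> nat) := [set p : T * T | [&& p.1 != p.2,
  ~~ lab p.1 p.2 & (D p.1 p.2 == 1) || (D p.1 p.2 == dl)]].
have [n] : exists n, #|bad D| <= n by eexists; exact: leqnn.
elim: n D => [|n IH] D hn okD ext; have [b0|[[u v]]] := set_0Vmem (bad D).
1,3: exists D; split=> // x y xy hxy; apply/negPn/negP => nl.
1,2: by have := in_set0 (x, y); rewrite -b0 inE /= xy nl; case: hxy => ->; rewrite eqxx ?orbT.
- by move: hn; rewrite leqn0 cards_eq0 => /eqP->; rewrite inE.
move=> buv; have := buv; rewrite inE /= => /and3P[uv luv hD].
have [D' [okD' D'uv D'vu D'v]] := change_dist okD uv ltac:(by case/orP: hD => /eqP; tauto).
have d3 := nice_d nP.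
apply: (IH D') => // [|x y d lxy].
  rewrite -ltnS; apply: leq_trans hn; apply: proper_card; apply/properP; split.
    apply/subsetP => -[x y]; rewrite !inE /= => /and3P[-> -> /=].
    have [h|] := boolP (((x, y) != (u, v)) && ((x, y) != (v, u))); first by rewrite D'v.
    by rewrite negb_and !negbK => /orP[] /eqP[-> ->]; rewrite ?D'vu; lia.
  by exists (u, v) => //; rewrite inE /=; lia.
rewrite D'v; first exact: ext.
apply/andP; split; apply/eqP => -[ex ey]; move: luv; rewrite -ex -ey; last rewrite sy;
  by rewrite lxy.
Qed.

Lemma dist_metric (T : finType) (D : T -> T -> nat) : dist_ok D -> is_metric D.
Proof.
move=> [D0 Dsy _ Dc]; split=> // [x y|x y z]; first by rewrite (rwP eqP) D0; split; move/eqP.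
by have /and4P[] := Dc x y z.
Qed.

Lemma dist_class_A (X : finspace) : dist_ok (@fdist X) <-> class_A P X.
Proof.
have [d0 dS _] := fdistP X; split=> [[D0 _ Dle Dc]|AX].
  have rg (x y : X) : x <> y -> 0 < fdist x y <= dl by move=> /eqP ne; rewrite Dle lt0n D0 ne.
  split=> // x y z /rg/andP[xy _] /rg/andP[yz _] /rg/andP[xz _].
  by have /(compat_allowed _ xy yz xz)[] := Dc x y z.
split=> // [x y|x y|]; [by apply/eqP/eqP; rewrite d0| |exact: metric_compat nP AX].
have [->|/eqP ne] := eqVneq x y; first by rewrite (proj2 (d0 _ _)).
by have [/(_ _ _ ne)/andP[]] := AX.
Qed.
End Distances.

(** * Auxiliary linear orders *)

Section Pullback.
Variables (T U : Type) (h : T -> U) (inj : injective h) (b : lin_order U).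
Lemma pullback_total : total (fun x y => b (h x) (h y)).
Proof. by move=> x y; exact: (@lo_total _ b). Qed.

Lemma pullback_trans : transitive (fun x y => b (h x) (h y)).
Proof. by move=> y x z; exact: (@lo_trans _ b). Qed.

Lemma pullback_anti : antisymmetric (fun x y => b (h x) (h y)).
Proof. by move=> x y /(@lo_anti _ b)/inj. Qed.

Definition pullback : lin_order T := LinOrder pullback_total pullback_trans pullback_anti.
End Pullback.

Definition leq_order : lin_order nat := LinOrder leq_total (fun n m p => @leq_trans n m p) anti_leq.

Section LevelOrder.
Variables (T : finType) (lev : T -> nat).

(** The lexicographic order by level and then by enumeration of [T], coded in one number. *)
Lemma level_inj : injective (fun x => lev x * #|T| + enum_rank x).
Proof.
move=> x y; case: (posnP #|T|) => [T0|T1]; first by have := fintype0 x T0.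
by move/(congr1 (modn^~ #|T|)); rewrite !modnMDl !modn_small // => /val_inj/enum_rank_inj.
Qed.

Definition level_order : lin_order T := pullback level_inj leq_order.

Lemma level_orderW x y : lev x < lev y -> level_order x y.
Proof.
move=> l; apply: ltnW; apply: (@leq_trans ((lev x).+1 * #|T|));
  first by rewrite mulSn addnC ltn_add2r.
by apply: leq_trans (leq_addr _ _); rewrite leq_mul2r l orbT.
Qed.
End LevelOrder.

Lemma isometric_inj (X Y : finspace) (f : X -> Y) : isometric (@fdist X) (@fdist Y) f ->
  injective f.
Proof.
move=> iso x y e; have [d0 _ _] := fdistP X; have [d1 _ _] := fdistP Y.
by apply/d0; rewrite -iso; apply/d1.
Qed.

Lemma lo_refl T (a : lin_order T) x : a x x.
Proof. by have := @lo_total _ a x x; rewrite orbb. Qed.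

Lemma order_mono (T U : Type) (a : lin_order T) (b : lin_order U) (f : T -> U) : injective f ->
  (forall x y, a x y -> b (f x) (f y)) -> forall x y, b (f x) (f y) = a x y.
Proof.
move=> inj h x y; apply/idP/idP => [l|]; last exact: h.
have /orP[//|o] := @lo_total _ a x y.
have e : x = y by apply: inj; apply: (@lo_anti _ b); rewrite l h.
by rewrite e in o *.
Qed.

(** * The Ramsey property *)

Section RamseyProperty.
Variables (P : params) (M : nat) (S : mspace -> Prop).
Hypotheses (nP : nice P M) (S1d : forall H, S H -> one_delta_space P H).

Lemma stages (A B : ordspace) n (K : finType) : class_K P S A -> class_K P S B ->
  exists2 G : graph, graph_ok P n.+1 G & arrow A B K G.
Proof.
move=> KA KB; elim: n K => [|n IH] K; first exact: stage_base KA KB K.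
have [G okG arG] := IH (option K); have [G' [h1 _ h2]] := stage_up nP KA KB okG arG.
by exists G'.
Qed.

Theorem class_K_Ramsey : Ramsey (free_orderings (class_K P S)).
Proof.
move=> A B k KA KB k0.
have [n0 Hn0] := long_consistent nP.
have [G0 ok0 ar0] := @stages A B n0 (option 'I_k) KA KB.
(* [stages] does not record the absence of Henson cliques; one more stage supplies it. *)
have [G [[sy rg ir co] heG arG]] := stage_up nP KA KB ok0 ar0.
have okG : lab_ok P (@glab G).
  by split=> //; apply: Hn0 => // x p px lx sp; apply: co => //; rewrite ltnW // ltnS ltnW.
have [D [okD extD]] := complete_dist nP okG.
have {okD extD} [D' [okD extD extr]] := avoid_extremes nP sy okD extD.
pose X := FinSpace (dist_metric okD).
pose C := @OrdSpace X (level_order (@glevel G)).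
have KC : class_K P S C.
  split; first exact/(dist_class_A nP).
  move=> H SH [f isof]; apply: (heG H SH f) => x y xy.
  (* A Henson constraint has only the distances 1 and delta, which [avoid_extremes] leaves only on
     edges of [G]; an embedded constraint would therefore be a clique of [G]. *)
  have : glab (f x : G) (f y : G).
    apply: extr; last by have /= -> := isof x y; apply: (S1d SH).
    apply/eqP => e; apply: xy; have [d0 _ _] := mdistP H; apply/d0.
    by rewrite -isof; have [dX _ _] := fdistP X; apply/dX.
  by case E: (glab (f x : G) (f y)) => [d|//] _; have /= <- := isof x y; rewrite (extD _ _ _ E).
exists C; split=> // chi.
have [f fe fm] := arG (fun g => chi [set g a | a : A]).
have of_ : oembedding (f : B -> C).
  have isof : isometric (@fdist B) (@fdist C) f.
    have [d0 _ _] := fdistP B; have [dX _ _] := fdistP X.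
    move=> x y; have [->|/eqP xy] := eqVneq x y; first by rewrite (proj2 (d0 _ _)) // (proj2 (dX _
      _)).
    by have [e _] := fe x y xy; exact: (extD _ _ _ e).
  split=> //; apply: order_mono => [|x y o]; first exact: isometric_inj isof.
  have [->|/eqP xy] := eqVneq x y; first by rewrite lo_refl.
  by apply: level_orderW; have [_ /(_ o)] := fe x y xy.
pose B' : {set C} := [set f x | x : B].
have lift (A' : {set C}) : is_copy A A' -> A' \subset B' ->
    exists2 e : A -> B, oembedding e & A' = [set [ffun a => f (e a)] a | a : A].
  move=> [g [[g1 g2] ->]] sub.
  have /fin_all_exists[e eP] a : exists b, g a = f b.
    have /(subsetP sub)/imsetP[b _ ->] : g a \in [set g a | a : A] by exact: imset_f.
    by exists b.
  exists e; last by apply: eq_imset => a; rewrite ffunE.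
  by have [f1 f2] := of_; split=> x y; rewrite -?(f1 (e x)) -?(f2 (e x)) -!eP.
(* Without a copy of [A] in [B'] any colour will do, and one exists because the number of colours is
   positive. *)
have [[A0 [cA0 sA0]]|no] := classic (exists A', is_copy A A' /\ A' \subset B').
  exists B', (chi A0); split; first by exists f.
  by move=> A1 /lift h /h[e1 o1 ->]; have [e0 o0 ->] := lift _ cA0 sA0; apply: (fm e1 e0).
exists B', (Ordinal k0); split; first by exists f.
by move=> A1 c1 s1; case: no; exists A1.
Qed.
End RamseyProperty.

(** * The expansion property *)

Section Reverse.
Variables (T : Type) (b : lin_order T).
Lemma reverse_total : total (fun x y => b y x).
Proof. by move=> x y; exact: (@lo_total _ b). Qed.

Lemma reverse_trans : transitive (fun x y => b y x).
Proof. by move=> y x z h1 h2; exact: (@lo_trans _ b) h2 h1. Qed.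

Lemma reverse_anti : antisymmetric (fun x y => b y x).
Proof. by move=> x y; rewrite andbC => /(@lo_anti _ b). Qed.

Definition reverse : lin_order T := LinOrder reverse_total reverse_trans reverse_anti.
End Reverse.

Section Expansion.
Variables (P : params) (M : nat) (S : mspace -> Prop).
Hypotheses (nP : nice P M) (S1d : forall H, S H -> one_delta_space P H).
Hypothesis S4 : forall H, S H -> exists f : 'I_4 -> H, injective f.
Notation dl := (delta P).

Lemma small_class_AS (X : finspace) : #|X| <= 3 -> class_AS S X.
Proof.
move=> X3 H SH [f iso]; have [g inj] := S4 SH.
have := @leq_card 'I_4 X (fun i => f (g i)); rewrite card_ord leqNgt ltnS X3 => H4; apply: notF;
  apply: H4 => i j e.
apply: inj; have [d0 _ _] := mdistP H; have [d1 _ _] := fdistP X.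
by apply/d0; rewrite -iso; apply/d1.
Qed.

Definition edge_dist (d : nat) (x y : 'I_2) : nat := if x == y then 0 else d.

Lemma edge_ok d : 0 < d <= dl -> dist_ok P (edge_dist d).
Proof.
case/andP=> d0 hd; split=> [x y|x y|x y|x y z]; rewrite /edge_dist.
- by case: (x =P y) => // _; rewrite -leqn0 leqNgt d0.
- by rewrite eq_sym.
- by case: eqP.
by case: x => -[|[|]] // ?; case: y => -[|[|]] // ?; case: z => -[|[|]] // ?;
  rewrite -!val_eqE /= ?(compat00 nP) ?(compat_refl nP) // compat_swap (compat00 nP).
Qed.

Lemma edge_class d : 0 < d <= dl -> exists E : ordspace, class_K P S E /\
  forall (C : ordspace) (u v : C), u != v -> order_of C u v -> fdist u v = d -> is_copy E [set u;
    v].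
Proof.
move=> hd; pose X := FinSpace (dist_metric (edge_ok hd)).
have KX : class_K P S X.
  by split; [apply/(dist_class_A nP); exact: edge_ok | apply: small_class_AS; rewrite card_ord].
exists (@OrdSpace X (pullback val_inj leq_order)); split=> // C u v uv o duv.
have [d0 dS _] := fdistP C.
pose f (i : 'I_2) : C := if i == ord0 then u else v.
have iso : isometric (edge_dist d) (@fdist C) f.
  by case=> -[|[|]] // ?; case=> -[|[|]] // ?; rewrite /f /edge_dist -!val_eqE /= ?duv // ?(dS v)
    // (proj2 (d0 _ _)).
exists f; split; first split=> //.
  apply: (@order_mono X C (pullback val_inj leq_order)); first exact: (@isometric_inj X C).
  by case=> -[|[|]] // ?; case=> -[|[|]] // ?; rewrite /f -!val_eqE /= ?lo_refl.
apply/setP => w; rewrite !inE; apply/orP/imsetP => [[]/eqP->|[i _ ->]].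
- by exists ord0.
- by exists (lift ord0 ord0).
- by rewrite /f; case: ifP => _; rewrite eqxx; [left|right].
Qed.

(** One use of the Ramsey property for each distance: pairs at distance [d] in [C] are coloured by
    whether [b] agrees with the order of [C]. The distances treated earlier are settled by pulling
    [b] back to the monochromatic copy. *)
Lemma signs (ds : seq nat) (B0 : ordspace) : class_K P S B0 -> all (fun d => 0 < d <= dl) ds ->
  exists2 B : ordspace, class_K P S B & forall b : lin_order B, exists f : B0 -> B,
    oembedding f /\
    exists s : nat -> bool, forall x y, x != y -> order_of B0 x y -> fdist x y \in ds ->
      b (f x) (f y) = s (fdist x y).
Proof.
move=> KB0; elim: ds => [|d ds IH] /=.
  by exists B0 => // b; exists id; split=> //; exists xpredT.
case/andP=> hd /IH[B KB HB].
have [E [KE HE]] := edge_class hd.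
have [C [KC HC]] := class_K_Ramsey nP S1d KE KB (isT : 0 < 2).
exists C => // b.
pose chi (X : {set C}) : 'I_2 := inord [exists x in X, exists y in X, [&& x != y,
  order_of C x y & b x y]].
have [B' [c [[h [[h1 h2] eB']] mono]]] := HC chi.
have inj_h := isometric_inj h1.
have [f [f1 [s hs]]] := HB (pullback inj_h b).
exists (fun x => h (f x)); split.
  by case: f1 => f1 f2; split=> x y; rewrite ?h1 ?h2 ?f1 ?f2.
exists (fun e => if e == d then c == 1 :> nat else s e) => x y xy o.
rewrite inE; case: eqVneq => [exy _|_ /=]; last by move=> /(hs _ _ xy o).
pose u := h (f x); pose v := h (f y).
have uv : u != v by apply: contra_neq xy => /inj_h; exact: isometric_inj (proj1 f1) _ _.
have ouv : order_of C u v by rewrite h2 (proj2 f1).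
have duv : fdist u v = d by rewrite h1 (proj1 f1).
have := mono [set u; v] (HE _ _ _ uv ouv duv).
have -> : [set u; v] \subset B'.
  by rewrite eB' subUset !sub1set; apply/andP; split; exact: imset_f.
move=> /(_ isT) <-; rewrite /chi inordK ?ltnS ?leq_b1 // eqb1.
apply/idP/idP => [buv|/existsP[u' /andP[u'P /existsP[v' /and4P[v'P ne o' b']]]]].
  by apply/existsP; exists u; rewrite set21 /=; apply/existsP; exists v; rewrite set22 /= uv ouv.
have {}o' := conj o' ouv; move: u'P v'P ne o' b'; rewrite !in_set2 => /orP[]/eqP-> /orP[]/eqP->;
  rewrite ?eqxx //.
by move=> _ [o1 o2]; case/eqP: uv; apply: (@lo_anti _ (order_of C)); rewrite o1 o2.
Qed.

Lemma compat_MMj j : j <= dl -> [/\ compat P M M j, compat P M j M & compat P j M M].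
Proof. by move=> hj; split; [|rewrite compat_rot compat_rot|rewrite compat_rot]; apply:
(compat_MM nP). Qed.

(** * Spaces made of blocks at mutual distance M *)

Section Blocks.
Variables (T : finType) (J : eqType) (blk : T -> J) (D0 : T -> T -> nat).
Hypotheses (D00 : forall x y, blk x = blk y -> (D0 x y == 0) = (x == y))
  (D0sy : forall x y, blk x = blk y -> D0 x y = D0 y x) (D0le : forall x y, blk x = blk y ->
    D0 x y <= dl)
  (D0c : forall x y z, blk x = blk y -> blk y = blk z -> compat P (D0 x y) (D0 y z) (D0 x z)).
Definition block_dist (x y : T) : nat := if blk x == blk y then D0 x y else M.

(** A triangle meeting exactly two blocks has sides M, M, j, and one meeting three blocks has sides
    M, M, M; both are allowed. *)
Lemma block_ok : dist_ok P block_dist.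
Proof.
have /andP[M2 Md] := nice_M nP; have hM := ltnW Md.
have le x y : block_dist x y <= dl by rewrite /block_dist; case: eqP => [/D0le|].
split=> // [x y|x y|x y z]; rewrite /block_dist.
- case: (blk x =P blk y) => [/D00 //|ne]; apply/idP/eqP => [/eqP e|e]; last by rewrite e in ne.
  by rewrite e in M2.
- by rewrite eq_sym; case: (blk y =P blk x) => // e; rewrite D0sy.
have [MM1 MM2 MM3] := compat_MMj hM.
case: (blk x =P blk y) => [exy|nxy]; case: (blk y =P blk z) => [eyz|nyz].
- by rewrite exy eyz eqxx D0c.
- by rewrite exy; case: eqP => // _; have [] := compat_MMj (D0le exy).
- by rewrite -eyz; case: eqP => // _; have [] := compat_MMj (D0le eyz).
- by case: eqP => // exz; have [] := compat_MMj (D0le exz).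
Qed.
End Blocks.

(** The ends 0 and 2 are the only two distinct points with sum 2. *)
Definition path_dist (d : nat) (x y : 'I_3) : nat :=
  if x == y then 0 else if x + y == 2 then d else M.

Lemma path_ok d : 0 < d <= dl -> dist_ok P (path_dist d).
Proof.
case/andP=> d0 hd; have /andP[M2 Md] := nice_M nP; have hM := ltnW Md.
split=> [x y|x y|x y|x y z]; rewrite /path_dist.
- case: (x =P y) => // _; case: ifP => _; first by rewrite -leqn0 leqNgt d0.
  by case: (M) M2.
- by rewrite eq_sym addnC.
- by case: ifP => // _; case: ifP.
have [c1 c2 c3] := compat_MMj hd.
by case: x => -[|[|[|]]] // ?; case: y => -[|[|[|]]] // ?; case: z => -[|[|[|]]] // ?;
  rewrite -!val_eqE /= ?(compat00 nP) ?(compat_refl nP) // compat_swap (compat00 nP).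
Qed.

Section Universal.
Variables (A : finspace) (KA : class_K P S A).
Notation ranking := {ffun A -> 'I_#|A|}.
Notation point := (ranking * A + 'I_dl * 'I_3)%type.
(* All rankings of [A] and, for each [d], a path with distances [M], [M], [d], at mutual
   distance [M]. A linear order that on each distance agrees or disagrees uniformly with
   the level order does the same thing at [d] and at [M], by transitivity on the path. *)
Definition pblock (p : point) : ranking + 'I_dl := match p with inl u => inl u.1 |
  inr u => inr u.1 end.
(** The successor shifts the indices in ['I_dl] to the distances 1, ..., delta. The value 0 in the
    mixed case is a dummy, since [block_dist] consults [pdist] only inside a block. *)
Definition pdist (p q : point) : nat :=
  match p, q with
  | inl u, inl v => fdist u.2 v.2
  | inr u, inr v => path_dist u.1.+1 u.2 v.2
  | _, _ => 0
  end.
Definition plevel (p : point) : nat := match p with inl u => u.1 u.2 | inr u => u.2 end.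

Lemma universal_ok : dist_ok P (block_dist pblock pdist).
Proof.
have [A0 Asy Ale Ac] := proj2 (dist_class_A nP A) (proj1 KA).
have pok (d : 'I_dl) : dist_ok P (path_dist d.+1) by apply: path_ok; rewrite ltn_ord.
apply: block_ok.
- case=> -[j x] [] [j' y] //= [e]; subst j'; first by rewrite A0; apply/eqP/eqP => [->|[]].
  by have [h _ _ _] := pok j; rewrite h; apply/eqP/eqP => [->|[]].
- case=> -[j x] [] [j' y] //= [e]; subst j'; by have [_ h _ _] := pok j.
- case=> -[j x] [] [j' y] //= [e]; by have [_ _ h _] := pok j.
- case=> -[j x] [] [j' y] [] [j2 z] //= [e] [e2].
  by subst j' j2; have [_ _ _ h] := pok j.
Qed.

Definition universal : ordspace := @OrdSpace (FinSpace (dist_metric universal_ok)) (level_order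
  plevel).

(** As M lies strictly between 1 and delta, an embedded Henson constraint stays within one block. A
    block over a ranking is isometric to [A], which omits the constraint, and a path has fewer than
    4 points. *)
Lemma universal_class : class_K P S universal.
Proof.
have /andP[M2 Md] := nice_M nP.
split; first exact/(dist_class_A nP)/universal_ok.
move=> H SH [f iso]; have [g inj] := S4 SH.
have [d0 _ _] := mdistP H; have [dX _ _] := fdistP universal.
have sameb x y : pblock (f x) = pblock (f y).
  apply/eqP/negPn/negP => /eqP nb.
  have /(S1d SH) : x <> y by move=> e; rewrite e in nb.
  have /= <- := iso x y; rewrite /block_dist; case: eqP => // _; lia.
have iso' x y : pdist (f x) (f y) = mdist x y.
  by have /= <- := iso x y; rewrite /block_dist (sameb x y) eqxx.
case E: (f (g ord0)) => [[j a0]|[j i0]].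
  case: (proj2 KA H SH); exists (fun x => if f x is inl u then u.2 else a0) => x y; rewrite -iso'.
  by have := sameb x (g ord0); have := sameb y (g ord0); rewrite E; case: (f x) => // u; case:
    (f y).
pose h (i : 'I_4) := if f (g i) is inr u then u.2 else i0.
have inj_h : injective h.
  move=> k l; rewrite /h => e; apply: inj; apply/d0; rewrite -iso'.
  move: e; have := sameb (g k) (g ord0); have := sameb (g l) (g ord0); rewrite E.
  by case: (f (g k)) => // u _; case: (f (g l)) => // v _; rewrite /= /path_dist => ->;
    rewrite eqxx.
by have := leq_card h inj_h; rewrite !card_ord.
Qed.
End Universal.

Theorem class_K_expansion : expansion_property (class_K P S) (free_orderings (class_K P S)).
Proof.
have /andP[M2 Md] := nice_M nP.
move=> A KA.
have [|B KB HB] := signs (universal_class KA) (ds := iota 1 dl).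
  by apply/allP => d; rewrite mem_iota; lia.
exists B; split=> // a b _ _.
have [f0 [[iso of_] [s hs]]] := HB b.
have sM d : 0 < d <= dl -> s d = s M.
  case: d => // d hd; pose pt k : universal KA := inr (Ordinal hd, inord k).
  have ptd k l : k < 3 -> l < 3 -> k != l -> fdist (pt k) (pt l) = if k + l == 2 then d.+1 else M.
    move=> hk hl kl; rewrite /= /block_dist /= eqxx /path_dist -val_eqE /= !inordK // (negPf kl).
    by case: ifP.
  have E k l : k < l -> l < 3 -> b (f0 (pt k)) (f0 (pt l)) = s (if k + l == 2 then d.+1 else M).
    move=> kl hl; have hk := ltn_trans kl hl.
    have lt : plevel (pt k) < plevel (pt l) by rewrite /= !inordK.
    rewrite -(ptd k l) ?(ltn_eqF kl) //; apply: hs; first by apply: contraTneq lt => ->;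
      rewrite ltnn.
      exact: level_orderW.
    by rewrite ptd ?(ltn_eqF kl) // mem_iota; case: ifP; lia.
  have [E01 E12 E02] := And3 (E 0 1 isT isT) (E 1 2 isT isT) (E 0 2 isT isT).
  rewrite /= in E01 E12 E02; rewrite -E02; case: (s M) E01 E12 => E01 E12.
    exact: (@lo_trans _ b) E01 E12.
  have tot k l : b (f0 (pt k)) (f0 (pt l)) = false -> b (f0 (pt l)) (f0 (pt k)).
    by move=> h; have := @lo_total _ b (f0 (pt k)) (f0 (pt l)); rewrite h.
  have o20 := @lo_trans _ b _ _ _ (tot _ _ E12) (tot _ _ E01).
  apply/negP => o02; have /(isometric_inj iso) e : f0 (pt 0) = f0 (pt 2) by apply: (@lo_anti _ b);
    rewrite o02 o20.
  by have := ptd 0 2 isT isT isT; have [dU _ _] := fdistP (universal KA);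
    rewrite e (proj2 (dU _ _)).
(* If the common sign is negative, [b] reverses the level order on the chosen copy, so the block
   ranked by the reverse of [a] shows [a]. *)
pose a' := if s M then a else reverse a.
pose j : {ffun A -> 'I_#|A|} := [ffun x => Ordinal (@rank_max (OrdSpace a') x)].
pose g (x : A) : B := f0 (inl (j, x) : universal KA).
have isog : isometric (@fdist A) (@fdist B) g.
  by move=> x y; rewrite /g iso /= /block_dist eqxx.
exists g; split=> //; apply: order_mono; first exact: isometric_inj isog.
move=> x y axy; have [->|xy] := eqVneq x y; first exact: lo_refl.
have key u v : u != v -> a' u v -> b (g u) (g v) = s M.
  move=> uv auv; have [d0 _ _] := fdistP A; have [[rg _] _] := KA.
  have /rg uvd : u <> v by apply/eqP.
  have fuv : fdist (inl (j, u) : universal KA) (inl (j, v)) = fdist u v by rewrite /= /block_dist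
    eqxx.
  rewrite -(sM (fdist u v) uvd) -fuv; apply: hs; last by rewrite fuv mem_iota; lia.
    by apply: contra_neq uv => -[].
  by apply: level_orderW; rewrite /= !ffunE /=; apply: rank_lt.
rewrite /a' in key; case: (s M) key => key; first exact: key.
have := @lo_total _ b (g x) (g y); rewrite (key y x) ?orbF //; by rewrite eq_sym.
Qed.
End Expansion.

Theorem theorem5p4 (P : params) (S : mspace -> Prop)
    (adm : primitive_admissible P S) (S_nonempty : exists H : mspace, S H) :
  Ramsey (free_orderings (class_K P S)) /\
  expansion_property (class_K P S) (free_orderings (class_K P S)).
Proof.
have [admP HS exIII] := adm; have [H0 SH0] := S_nonempty.
have [|M nP] := admissible_nice admP.
  by case/exIII => h1 h2; split=> [/h1|/h2] /(_ H0).
split; first by apply: (class_K_Ramsey nP) => H /HS[].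
by apply: (class_K_expansion nP) => H /HS[].
Qed.
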